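(* Let $x,y$ be Hermitian $n\times n$ complex matrices, let $t_0>0$, and let $u(t)=e^{itx}e^{iy}=e^{iz(t)}$ be a curve such that $\|e^{itx}e^{iy}-1\|<\sqrt{2}$ for all $t\in[0,t_0]$, with eigenvalues $e^{i\theta_k(t)}$, where $\theta_1(t)\ge\theta_2(t)\ge\dots\ge\theta_n(t)$ are the eigenvalues of $z(t)=-i\log(u(t))$, for all $t\in[0,t_0]$. Let $\mu$ be a real diagonal matrix with diagonal entries $\mu_1>\mu_2>\dots>\mu_n$. Then the function on $[0,t_0]$ $$t\mapsto f_\mu(z(t))=\sup_{w\in U_n(\mathbb C)}\mathrm{tr}(w\mu w^{-1}z(t))=\mu_1\theta_1(t)+\mu_2\theta_2(t)+\dots+\mu_n\theta_n(t)$$ is strictly convex if and only if $x$ and $y$ do not commute. If $x$ and $y$ commute, then this function is piecewise linear.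
   Context: $\|\cdot\|$ denotes the spectral (operator) norm on $M_n(\mathbb C)$, and $U_n(\mathbb C)$ is the group of $n\times n$ unitary matrices. For a unitary matrix $u$ with $\|u-1\|<2$, $\log(u)$ is the principal branch of the logarithm, so $-i\log(u)$ is the unique Hermitian matrix $z$ with $e^{iz}=u$ and $\|z\|<\pi$.
   Formalization: The equivalence ''strictly convex iff x and y do not commute'' is stated under the extra assumption ‖y‖<π; without it, it fails, e.g. y=2πP with P a rank-one projection not commuting with x, where e^{iy}=1 and the function is linear for small t. *)

(* Defs.v *)
From HB Require Import structures.
From mathcomp Require Export all_boot all_order all_algebra.
From mathcomp Require Export all_classical all_reals all_analysis.
From mathcomp Require Export complex.

Set Implicit Arguments.
Unset Strict Implicit.
Unset Printing Implicit Defensive.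

Import Order.TTheory GRing.Theory Num.Theory.
Import numFieldNormedType.Exports.

Local Open Scope classical_set_scope.
Local Open Scope ring_scope.
Local Open Scope complex_scope.

Section Matrices.
Context {R : realType} {n : nat}.
Local Notation C := R[i].

(* The limit is the entrywise one in 'M[C]_n. *)
Definition expmx (A : 'M[C]_n) : 'M[C]_n :=
  limn (series (fun k : nat => (k`!%:R)^-1 *: A ^+ k)).

Definition l2norm (v : 'cV[C]_n) : R :=
  Num.sqrt (\sum_(i < n) Normc.normc (v i 0) ^+ 2).

(* The spectral norm: operator norm for the Euclidean norm on C^n. *)
Definition opnorm (A : 'M[C]_n) : R :=
  sup [set l2norm (A *m v) | v in [set v | l2norm v <= 1]].

(* Principal logarithm of a unitary u with opnorm (u - 1) < 2, through its
   characterization: - 'i log u is the unique Hermitian z such that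
   e^(i z) = u and opnorm z < pi.  The value is 0 if there is no such z. *)
Definition logmx (u : 'M[C]_n) : 'M[C]_n :=
  'i *: xget 0 [set z : 'M[C]_n |
    [/\ z \is hermsymmx, expmx ('i *: z) = u & opnorm z < pi]].

(* theta 0 0 >= theta 0 1 >= ... are the eigenvalues of A (all real), each
   listed with its algebraic multiplicity. *)
Definition sorted_eigenvalues (A : 'M[C]_n) (theta : 'rV[R]_n) : Prop :=
  char_poly A = \prod_(k < n) ('X - ((theta 0 k)%:C)%:P) /\
  {homo (fun k : 'I_n => theta 0 k) : j k / (j <= k)%N >-> k <= j}.

(* f_mu(z) = sup over unitary w of tr(w mu w^-1 z), with mu the diagonal matrix
   whose diagonal is the row vector mu; the trace is real for z Hermitian. *)
Definition f_mu (mu : 'rV[R]_n) (z : 'M[C]_n) : R :=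
  sup [set r : R | exists2 w : 'M[C]_n, w \is unitarymx &
    r%:C = \tr (w *m diag_mx (map_mx (real_complex R) mu) *m invmx w *m z)].

Definition curve (x y : 'M[C]_n) (t : R) : 'M[C]_n :=
  expmx (('i * t%:C) *: x) *m expmx ('i *: y).

End Matrices.

Section RealFunctions.
Context {R : realType}.

Definition strictly_convex_on (a b : R) (f : R -> R) : Prop :=
  forall s t l : R, s \in `[a, b] -> t \in `[a, b] -> s != t -> 0 < l < 1 ->
    f (l * s + (1 - l) * t) < l * f s + (1 - l) * f t.

(* The pieces are closed intervals with common endpoints, so such a function
   is continuous on [a, b]. *)
Definition piecewise_linear_on (a b : R) (f : R -> R) : Prop :=
  exists2 s : seq R, itv_partition a b s &
    forall i : nat, (i < size s)%N -> exists c d : R,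
      forall t : R, t \in `[nth b (a :: s) i, nth b (a :: s) i.+1] ->
        f t = c * t + d.

End RealFunctions.

(* Main.v *)
(* Write F(u) for the sum of mu_k phi_k, where phi_1 >= ... >= phi_n are the phases of u.
   If M = w mu w^* commutes with W = e^{iz}, then comparing tr (M log U) with Im tr (M W^* U)
   costs at most a multiple of Re tr (1 - W^* U), because |d - sin d| <= C (1 - cos d) as long
   as |d| stays away from 2 pi.  Hence F grows along s |-> e^{isB} U at rate at most F(e^{iB}),
   and summing small steps gives F(e^{iB} U) <= F(e^{iB}) + F(U) when all phases of e^{iB} and
   U lie in (-pi/2, pi/2); the rigidity of the rearrangement inequality shows that equality
   forces e^{iB} and U to commute.  Midpoint convexity follows: with b = u(s), X = e^{ihx} and
   a = X b X, the matrix a is conjugate to u(s + 2h) and b a is conjugate to u(s + h)^2, whose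
   phases are twice those of u(s + h).  Equality forces X, hence x, to commute with u(s) and
   so with y.  If x and y commute, then z(t) is affine in t in a common eigenbasis, and f_mu is
   a maximum of finitely many affine functions. *)

From HB Require Import structures.
Require Import Defs.
From mathcomp Require Import ring lra zify perm.

Set Implicit Arguments.
Unset Strict Implicit.
Unset Printing Implicit Defensive.

Import Order.TTheory GRing.Theory Num.Theory.
Import numFieldNormedType.Exports.

Local Open Scope classical_set_scope.
Local Open Scope ring_scope.
Local Open Scope complex_scope.

(** Since |e^{ia} - 1|^2 = 2 - 2 cos a, the bound sqrt 2 says that every eigenvalue of u(t) has
    positive real part. Two obstacles shape the proof. Eigenvalues of u(t) may cross, and there the
    sorted phases need not be differentiable. So no phase is ever differentiated: growth is read off
    from traces against a fixed M, taken diagonal in an eigenbasis of the end point of each step.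
    Moreover e^{i.} forgets multiples of 2 pi, so every return from a unitary matrix to a Hermitian
    one needs phases that differ by less than 2 pi. For u(t) this is the hypothesis. For a product
    of two factors with phases in [-A, A], A < pi/2, the numerical range gives phases in [-2A, 2A].
    For e^{ihx}, with x of any size, the curve itself decides: if h |xi_k| >= pi for an eigenvalue
    xi_k of x, then e^{ih'x} has eigenvalue -1 for some 0 < h' <= h, and -1 cannot occur in a
    quotient of two points of the curve. For e^{iy} it is the bound on the norm of y. *)

(** * Scalar inequalities for sine and cosine, and summation of small steps *)

Section RealAnalysis.
Context {R : realType}.
Implicit Types x t a b : R.

Lemma ger0_derive_le (f df : R -> R) a b :
  (forall t, is_derive t 1 f (df t)) -> (forall t, a < t < b -> 0 <= df t) ->
  a <= b -> f a <= f b.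
Proof.
move=> fdf df0 ab.
apply: (@ger0_derive1_le_cc _ f a b) => //.
- by move=> t; rewrite in_itv/= => tab; rewrite derive1E derive_val df0.
- apply/continuous_subspaceT => t.
  by apply: differentiable_continuous; apply/derivable1_diffP; have [] := fdf t.
- by rewrite in_itv/= lexx ab.
- by rewrite in_itv/= lexx ab.
Qed.

Lemma sin_le x : 0 <= x -> sin x <= x.
Proof.
move=> x0; rewrite -subr_ge0.
have -> : (0 : R) = 0 - sin 0 by rewrite sin0 subr0.
apply: (@ger0_derive_le (fun t => t - sin t) (fun t => 1 - cos t)) => //.
Qed.

Lemma onem_cos_le x : 1 - cos x <= x ^+ 2 / 2.
Proof.
wlog x0 : x / 0 <= x => [H|].
  have [/H//|/ltW x0] := leP 0 x.
  by rewrite -cosN -sqrrN H // oppr_ge0.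
rewrite -subr_ge0.
have -> : (0 : R) = 0 ^+ 2 / 2 - (1 - cos 0) by rewrite cos0; lra.
apply: (@ger0_derive_le (fun t => t ^+ 2 / 2 - (1 - cos t)) (fun t => t - sin t)) => //.
- move=> t; apply: is_derive_eq; rewrite /GRing.scale/=; lra.
by move=> t /andP[t0 _]; rewrite subr_ge0 sin_le // ltW.
Qed.

Lemma normB_sin_le x : `|x - sin x| <= x ^+ 2.
Proof.
wlog x0 : x / 0 <= x => [H|].
  have [/H//|/ltW x0] := leP 0 x.
  have -> : x - sin x = - (- x - sin (- x)) by rewrite sinN; ring.
  by rewrite normrN -sqrrN H // oppr_ge0.
rewrite ger0_norm ?subr_ge0 ?sin_le // -subr_ge0.
have -> : (0 : R) = 0 ^+ 2 - (0 - sin 0) by rewrite sin0; lra.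
apply: (@ger0_derive_le (fun t => t ^+ 2 - (t - sin t)) (fun t => 2 * t - (1 - cos t))) => //.
- move=> t; apply: is_derive_eq; rewrite /GRing.scale/=; lra.
move=> t /andP[t0 _]; have := onem_cos_le t; have := cos_geN1 t => c1 c2.
have [t2|t2] := leP t 2; nra.
Qed.

Lemma ler_cos x t : 0 <= x -> x <= t -> t <= pi -> cos t <= cos x.
Proof.
move=> x0 xt tp.
by rewrite leNgt ltr_cos ?in_itv/= -?leNgt ?x0 ?tp ?(le_trans x0) ?(le_trans xt).
Qed.

Lemma cos_abs_ge a x : 0 <= a <= pi -> `|x| <= a -> cos a <= cos x.
Proof.
move=> /andP[a0 ap] xa; rewrite -(cos_norm x).
by rewrite ler_cos.
Qed.

(** At 0 the left side vanishes to third order and the right side to second. At 2 pi the right side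
    vanishes again while the left one does not, so the constant must blow up as [d] approaches 2 pi;
    [e] measures the distance kept from there. *)
Lemma normB_sin_le_cos (d : R) : d < pi *+ 2 ->
  exists2 C, 0 <= C & forall x, `|x| <= d -> `|x - sin x| <= C * (1 - cos x).
Proof.
move=> d2; have pi2 := @pi_ge2 R.
pose e := Num.min (pi *+ 2 - d) (pi / 2).
have e0 : 0 < e by rewrite lt_min; apply/andP; split; lra.
have ed : e <= pi *+ 2 - d by rewrite ge_min lexx.
have ep : e <= pi / 2 by rewrite ge_min lexx orbT.
have ce : cos e < 1.
  rewrite -(@cos0 R) ltr_cos ?in_itv/= ?lexx//; lra.
exists (1 + (pi *+ 2 + 1) / (1 - cos e)).
  by rewrite addr_ge0 // divr_ge0; lra.
move=> x; wlog x0 : x / 0 <= x => [H xd|].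
  have [/H|/ltW x0] := leP 0 x; first exact.
  move: xd; rewrite -normrN => xd.
  have -> : x - sin x = - (- x - sin (- x)) by rewrite sinN; ring.
  by rewrite normrN -(cosN x) H // oppr_ge0.
rewrite (ger0_norm x0) => xd.
rewrite ger0_norm ?subr_ge0 ?sin_le //.
have c1 : 0 <= 1 - cos x by rewrite subr_ge0 cos_le1.
have C0 : 0 <= (pi *+ 2 + 1) / (1 - cos e) by rewrite divr_ge0; lra.
(* Up to pi/2 the constant 1 suffices, because sin + cos >= 1 there. Beyond it 1 - cos x >= 1 - cos
   e, while x - sin x is at most 2 pi + 1. *)
have [xe|xe] := leP x (pi / 2).
  have : 0 <= 1 - cos x - (x - sin x).
    have -> : (0 : R) = (1 - cos 0) - (0 - sin 0) by rewrite sin0 cos0; lra.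
    apply: (@ger0_derive_le (fun t => 1 - cos t - (t - sin t))
              (fun t => sin t - (1 - cos t))) => //.
    - move=> t; apply: is_derive_eq; lra.
    move=> t /andP[t0 tx].
    have s0 : 0 <= sin t by rewrite sin_ge0_pi //; apply/andP; split; lra.
    have cc0 : 0 <= cos t by rewrite cos_ge0_pihalf //; apply/andP; split; lra.
    by have := cos2Dsin2 t; nra.
  nra.
have cx : cos x <= cos e.
  have [xp|xp] := leP x pi.
    by rewrite ler_cos //; lra.
  rewrite -(cosN x) -(cosD2pi (- x)).
  by rewrite ler_cos //; lra.
have : (pi *+ 2 + 1) / (1 - cos e) * (1 - cos e) = pi *+ 2 + 1.
  by rewrite mulfVK //; lra.
have := sin_geN1 x; nra.
Qed.

(* Errors quadratic in the step sum up to O(1/N) over N steps. *)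
Lemma nonincreasing_of_quadratic_steps (G : R -> R) (C : R) :
  (forall s h, 0 <= s -> 0 <= h -> s + h <= 1 -> G (s + h) <= G s + C * h ^+ 2) ->
  forall s t, 0 <= s -> s <= t -> t <= 1 -> G t <= G s.
Proof.
move=> HG s t s0 st t1.
pose D := `|C| + 1.
have step N : G t <= G s + D / N.+1%:R.
  pose h := (t - s) / N.+1%:R.
  have N0 : (0 : R) < N.+1%:R by rewrite ltr0n.
  have h0 : 0 <= h by rewrite divr_ge0 ?subr_ge0 // ltW.
  have hN : h * N.+1%:R = t - s by rewrite /h mulfVK // lt0r_neq0.
  have hk k : (k <= N.+1)%N -> G (s + h * k%:R) <= G s + D * h ^+ 2 * k%:R.
    elim: k => [|k IH] kN; first by rewrite !mulr0 !addr0.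
    have kN' : k.+1%:R <= N.+1%:R :> R by rewrite ler_nat.
    have -> : s + h * k.+1%:R = s + h * k%:R + h by rewrite -natr1; ring.
    apply: le_trans (HG _ _ _ _ _) _ => //.
    - by rewrite addr_ge0 // mulr_ge0.
    - rewrite -natr1 in kN'; nra.
    have := IH (ltnW kN); rewrite -natr1 /D.
    have := sqr_ge0 h; have := ler_norm C; nra.
  have := hk N.+1 (leqnn _); rewrite hN addrC subrK => /le_trans; apply.
  rewrite lerD2l -mulrA ler_wpM2l ?addr_ge0 //.
  rewrite expr2 -mulrA hN /h.
  by rewrite mulrAC ler_piMl ?invr_ge0 ?(ltW N0)//; nra.
apply/ler_addgt0Pr => e e0.
have D0 : 0 < D by rewrite /D; have := normr_ge0 C; lra.
have [N] := ltr_add_invr (divr_gt0 e0 D0); rewrite add0r ltr_pdivlMr // => HN.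
by apply: le_trans (step N) _; rewrite lerD2l mulrC ltW.
Qed.

End RealAnalysis.

(** * From strict midpoint inequalities to strict convexity *)

Section StrictConvexity.
Context {R : realType}.
Implicit Types (s t a b : R) (f : R -> R).

Lemma lipschitz_within_continuous f a b L :
  (forall s t, s \in `[a, b] -> t \in `[a, b] -> `|f s - f t| <= L * `|s - t|) ->
  {within `[a, b], continuous f}.
Proof.
move=> Lf; apply/subspace_continuousP => s sab; apply/cvgrPdist_lt => e e0.
have L0 : 0 < `|L| + 1 by have := normr_ge0 L; lra.
near=> t.
have tab : t \in `[a, b] by near: t; exact: withinT.
apply: le_lt_trans (Lf _ _ sab tab) _.
have st : `|s - t| < e / (`|L| + 1).
  near: t; apply: cvg_within.
  by apply: nbhsx_ballx; rewrite divr_gt0.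
rewrite ltr_pdivlMr // in st.
have := ler_norm L; have := normr_ge0 (s - t); nra.
Unshelve. all: by end_near. Qed.

(* An interior maximum of [f] minus its chord would contradict the midpoint inequality. *)
Lemma strictly_convex_of_midpoint f a b L :
  (forall s t, s \in `[a, b] -> t \in `[a, b] -> `|f s - f t| <= L * `|s - t|) ->
  (forall s t, a <= s -> s < t -> t <= b -> f ((s + t) / 2) < (f s + f t) / 2) ->
  strictly_convex_on a b f.
Proof.
move=> Lf mf.
have main s t l : a <= s -> s < t -> t <= b -> 0 < l < 1 ->
    f (l * s + (1 - l) * t) < l * f s + (1 - l) * f t.
  move=> sa st tb /andP[l0 l1].
  pose c := (f t - f s) / (t - s).
  have cE : c * (t - s) = f t - f s by rewrite /c mulfVK //; lra.
  pose phi r := f r - c * (r - s).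
  have [m /[!in_itv]/= /andP[sm mt] max] : exists2 m, m \in `[s, t] &
      forall r, r \in `[s, t] -> phi r <= phi m.
    apply: EVT_max; first exact: ltW.
    apply: (@lipschitz_within_continuous _ _ _ (L + `|c|)) => p q.
    rewrite !in_itv/= => /andP[sp pt] /andP[sq qt].
    have -> : phi p - phi q = (f p - f q) + (- c) * (p - q) by rewrite /phi; ring.
    apply: le_trans (ler_normD _ _) _.
    rewrite normrM normrN mulrDl lerD2r; apply: Lf; rewrite in_itv/=; apply/andP; split; lra.
  have int q : s < q -> q < t -> exists2 r, r \in `[s, t] & phi q < phi r.
    move=> sq qt; pose d := Num.min (q - s) (t - q).
    have d0 : 0 < d by rewrite lt_min; apply/andP; split; lra.
    have d1 : d <= q - s by rewrite ge_min lexx.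
    have d2 : d <= t - q by rewrite ge_min lexx orbT.
    have mq : f q < (f (q - d) + f (q + d)) / 2.
      have {1}-> : q = (q - d + (q + d)) / 2 by field.
      by apply: mf; lra.
    have [h|h] := ltP (phi q) (phi (q - d)).
      by exists (q - d) => //; rewrite in_itv/=; apply/andP; split; lra.
    exists (q + d); first by rewrite in_itv/=; apply/andP; split; lra.
    by move: h; rewrite /phi; lra.
  set p := l * s + (1 - l) * t.
  have sp : s < p by rewrite /p; nra.
  have pt : p < t by rewrite /p; nra.
  have phis : phi s = f s by rewrite /phi subrr mulr0 subr0.
  have phit : phi t = f s by rewrite /phi cE; ring.
  have [r rst pr] := int p sp pt.
  have rm := max r rst.
  have ms : phi m <= f s.
    have [sm'|sm'] := ltP s m; last first.
      by have -> : m = s by [lra]; rewrite phis.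
    have [mt'|mt'] := ltP m t; last first.
      by have -> : m = t by [lra]; rewrite phit.
    have [q qst mq] := int m sm' mt'.
    by have := max q qst; lra.
  have : phi p < f s by lra.
  rewrite /phi.
  have -> : c * (p - s) = (1 - l) * (c * (t - s)) by rewrite /p; ring.
  rewrite cE; nra.
move=> s t l /[!in_itv]/= /andP[as_ sb] /andP[at_ tb] st l01.
have [st'|ts|e] := ltgtP s t; first exact: main.
  have l01' : 0 < 1 - l < 1 by move: l01 => /andP[l0 l1]; apply/andP; split; lra.
  have := main t s (1 - l) at_ ts sb l01'.
  have -> : (1 - l) * t + (1 - (1 - l)) * s = l * s + (1 - l) * t by ring.
  lra.
by rewrite e eqxx in st.
Qed.

End StrictConvexity.

(** * Maxima of finitely many affine functions *)

Section PiecewiseLinear.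
Context {R : realType}.

Lemma piecewise_linear_max (I : finType) (c d : I -> R) (f : R -> R) (a b : R) :
  a < b ->
  (forall t i, t \in `[a, b] -> c i * t + d i <= f t) ->
  (forall t, t \in `[a, b] -> exists i, f t = c i * t + d i) ->
  piecewise_linear_on a b f.
Proof.
move=> ab fge fex.
pose s0 := [seq (d j - d i) / (c i - c j) | i <- enum I, j <- enum I].
pose s1 := sort <=%O (undup [seq r <- s0 | a < r < b]).
have s1P r : (r \in s1) = (r \in s0) && (a < r < b).
  by rewrite mem_sort mem_undup mem_filter andbC.
have as1 : path <%R a s1.
  rewrite path_min_sorted ?sort_lt_sorted ?undup_uniq //.
  by apply/allP => r; rewrite s1P => /and3P[].
have as2 : path <%R a (rcons s1 b).
  rewrite rcons_path as1/=.
  by have := mem_last a s1; rewrite inE => /predU1P[->//|]; rewrite s1P => /and3P[].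
exists (rcons s1 b); first by split=> //; rewrite last_rcons.
set s := a :: rcons s1 b.
have ss : sorted <%R s by [].
have sab r : r \in s -> a <= r <= b.
  rewrite inE mem_rcons inE => /or3P[/eqP->|/eqP->|]; rewrite ?lexx ?(ltW ab)//.
  by rewrite s1P => /and3P[_ /ltW-> /ltW->].
move=> i; rewrite size_rcons => isz.
have i1 : (i < size s)%N by rewrite /= size_rcons; lia.
have i2 : (i.+1 < size s)%N by rewrite /= size_rcons; lia.
set p := nth b s i; set q := nth b s i.+1.
have pq : p < q by rewrite (lt_sorted_ltn_nth b ss) // inE.
have /andP[ap pb] := sab p (mem_nth _ i1).
have /andP[aq qb] := sab q (mem_nth _ i2).
have nobreak r : r \in s0 -> p < r -> r < q -> False.
  move=> rs0 pr rq.
  have rs : r \in s.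
    rewrite inE mem_rcons inE s1P rs0/=.
    by rewrite (le_lt_trans ap pr) (lt_le_trans rq qb) !orbT.
  move: pr rq; rewrite -(nth_index b rs) /p /q.
  have k1 : (index r s < size s)%N by rewrite index_mem.
  rewrite (lt_sorted_ltn_nth b ss) ?inE // (lt_sorted_ltn_nth b ss) ?inE //.
  by rewrite ltnS => ir /(leq_trans ir); rewrite ltnn.
have inab t : p <= t -> t <= q -> t \in `[a, b].
  by move=> pt tq; rewrite in_itv/=; apply/andP; split; lra.
pose m := (p + q) / 2.
have pm : p < m by rewrite /m; lra.
have mq : m < q by rewrite /m; lra.
have mab := inab m (ltW pm) (ltW mq).
(* The line that attains [f] at the midpoint of a piece serves on the whole piece: a line strictly
   above it at some t would meet it between m and t, at a breakpoint inside the piece. *)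
have [k fm] := fex m mab.
exists (c k), (d k) => t /[!in_itv]/= /andP[pt tq].
have tab := inab t pt tq.
have [l ft] := fex t tab.
have := fge t k tab; rewrite le_eqVlt => /predU1P[//|lt].
have := fge m l mab; rewrite fm => le.
exfalso.
have cne : c l - c k != 0.
  by apply/eqP => e; have e' : c l = c k by [lra]; rewrite e' in le ft; lra.
have rs0 : (d k - d l) / (c l - c k) \in s0.
  by apply/allpairsP; exists (l, k); rewrite !mem_enum.
have := nobreak _ rs0.
have : (d k - d l) / (c l - c k) * (c l - c k) = d k - d l by rewrite mulfVK.
move: ((d k - d l) / (c l - c k)) => r er.
rewrite ft in lt.
have lt1 : 0 < (c l - c k) * (t - r) by lra.
have le1 : (c l - c k) * (m - r) <= 0 by lra.
have [c0|c0] := ltP 0 (c l - c k).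
  have h1 : r < t by move: lt1; rewrite pmulr_rgt0 // subr_gt0.
  have h2 : m <= r by move: le1; rewrite pmulr_rle0 // subr_le0.
  by apply; lra.
have {}c0 : c l - c k < 0 by rewrite lt_neqAle cne.
have h1 : t < r by move: lt1; rewrite nmulr_rgt0 // subr_lt0.
have h2 : r <= m by move: le1; rewrite nmulr_rle0 // subr_ge0.
by apply; lra.
Qed.

Lemma piecewise_linear_not_strictly_convex (f : R -> R) (a b : R) :
  a < b -> piecewise_linear_on a b f -> ~ strictly_convex_on a b f.
Proof.
move=> ab [[|p s] [/= ps /eqP lb] lin]; first by rewrite lb ltxx in ab.
move=> cvx.
move: ps => /andP[ap ps].
have pb : p <= b.
  by apply: (@itv_partition_le _ _ _ _ s); split=> //; apply/eqP.
have [c [d cd]] := lin 0%N isT.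
have := cvx a p (1 / 2); rewrite !in_itv/= lexx (ltW ap) (ltW ab) pb.
have h t : a <= t -> t <= p -> f t = c * t + d by move=> ? ?; apply: cd; rewrite in_itv/=; apply/andP.
rewrite !h ?lexx//; try lra.
Qed.

End PiecewiseLinear.

(** * The rearrangement inequality and its equality case *)

Section Rearrangement.
Context {R : realFieldType}.

(* [u j - u k >= P k * (M j - M k)]: [u] is a discrete convex function of [M]
   with subgradient [P]; averaging consecutive [P]s makes the equality case rigid. *)
Lemma nat_rearrangement_potential (N : nat) (M P : nat -> R) :
  (forall i, (i.+1 < N)%N -> M i.+1 < M i) ->
  (forall i j, (i <= j < N)%N -> P j <= P i) ->
  exists u : nat -> R, forall j k, (j < N)%N -> (k < N)%N ->
    P k * (M j - M k) <= u j - u k /\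
    (P k * (M j - M k) = u j - u k -> P j = P k).
Proof.
move=> HM HP.
(* Trapezoidal sums of P against M. With [P i] alone as slope, the inequality between neighbours
   would be an equality in one direction even when [P i] and [P i.+1] differ. *)
pose u j := \sum_(i < j) (P i + P i.+1) / 2 * (M i.+1 - M i).
have uS j : u j.+1 = u j + (P j + P j.+1) / 2 * (M j.+1 - M j) by rewrite /u big_ord_recr.
clearbody u; exists u => j k; have [/subnKC <-|/ltnW /subnKC <-] := leqP j k.
  move: (k - j)%N => e; elim: e j => [|e IH] j jN kN.
    by rewrite addn0 !subrr mulr0.
  have [||h1 h2] := IH j.+1; [lia|lia|rewrite addSnnS in h1 h2].
  have m0 : M j.+1 < M j by apply: HM; lia.
  have p1 : P j.+1 <= P j by apply: HP; lia.
  have p2 : P (j + e.+1)%N <= P j.+1 by apply: HP; lia.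
  have uj := uS j.
  have h3 : 0 <= (P j + P j.+1 - 2 * P (j + e.+1)%N) * (M j - M j.+1) by nra.
  split=> [|e0]; first lra.
  have : (P j + P j.+1 - 2 * P (j + e.+1)%N) * (M j - M j.+1) = 0 by lra.
  by move/eqP; rewrite mulf_eq0 => /orP[] /eqP; lra.
move: (j - k)%N => e; elim: e => [|e IH] jN kN.
  by rewrite addn0 !subrr mulr0.
have [||h1 h2] := IH; [lia|lia|rewrite addnS].
have m0 : M (k + e).+1 < M (k + e)%N by apply: HM; lia.
have p1 : P (k + e)%N <= P k by apply: HP; lia.
have p2 : P (k + e).+1 <= P (k + e)%N by apply: HP; lia.
have uj := uS (k + e)%N.
have h3 : 0 <= (2 * P k - P (k + e)%N - P (k + e).+1) * (M (k + e)%N - M (k + e).+1) by nra.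
split=> [|e0]; first lra.
have : (2 * P k - P (k + e)%N - P (k + e).+1) * (M (k + e)%N - M (k + e).+1) = 0 by lra.
by move/eqP; rewrite mulf_eq0 => /orP[] /eqP; lra.
Qed.

(** A dual certificate for the assignment problem with gains [m j * p k]: feasible, tight on the
    diagonal, and tight elsewhere only between equal entries of [p]. The last clause carries the
    equality case. *)
Lemma rearrangement_potential n (m p : 'I_n -> R) :
  (forall j k : 'I_n, (j < k)%N -> m k < m j) ->
  {homo p : j k / (j <= k)%N >-> k <= j} ->
  exists u v : 'I_n -> R,
    [/\ forall j k, m j * p k <= u j + v k,
        forall k, m k * p k = u k + v k &
        forall j k, m j * p k = u j + v k -> p j = p k].
Proof.
case: n m p => [|n] m p mdec pdec; first by exists (fun=> 0), (fun=> 0); split=> [[]|[]|[]].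
have [||u Hu] := @nat_rearrangement_potential n.+1 (fun i => m (inord i)) (fun i => p (inord i)).
- by move=> i iN; apply: mdec; rewrite !inordK //; lia.
- by move=> i j ijN; apply: pdec; rewrite !inordK //; lia.
exists (fun j => u j), (fun k => m k * p k - u k).
split=> [j k|k|j k]; last 1 first.
- have [_] := Hu j k (ltn_ord j) (ltn_ord k); rewrite !inord_val => H e; apply: H; lra.
- by have [] := Hu j k (ltn_ord j) (ltn_ord k); rewrite !inord_val; lra.
- by ring.
Qed.

(** As all margins of [r] are 1, the deficit equals the sum of (u j + v k - m j * p k) * r j k,
    whose terms are nonnegative. If it vanishes, each term does, and [r] is supported where the
    certificate is tight. *)
Lemma doubly_stochastic_rearrangement n (m p : 'I_n -> R) (r : 'I_n -> 'I_n -> R) :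
  (forall j k : 'I_n, (j < k)%N -> m k < m j) ->
  {homo p : j k / (j <= k)%N >-> k <= j} ->
  (forall j k, 0 <= r j k) ->
  (forall j, \sum_k r j k = 1) -> (forall k, \sum_j r j k = 1) ->
  \sum_j \sum_k m j * p k * r j k <= \sum_k m k * p k /\
  (\sum_j \sum_k m j * p k * r j k = \sum_k m k * p k ->
   forall j k, r j k != 0 -> p j = p k).
Proof.
move=> mdec pdec r0 rj rk.
have [u [v [uv uvk uve]]] := rearrangement_potential mdec pdec.
have E : \sum_k m k * p k - \sum_j \sum_k m j * p k * r j k =
    \sum_j \sum_k (u j + v k - m j * p k) * r j k.
  transitivity (\sum_j \sum_k (u j + v k) * r j k - \sum_j \sum_k m j * p k * r j k).
    congr (_ - _).
    under [RHS]eq_bigr do under eq_bigr do rewrite mulrDl.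
    under [RHS]eq_bigr do rewrite big_split/= -mulr_sumr rj mulr1.
    rewrite big_split/= exchange_big/=.
    under [X in _ = _ + X]eq_bigr do rewrite -mulr_sumr rk mulr1.
    by rewrite -big_split/=; apply: eq_bigr.
  rewrite -sumrB; apply: eq_bigr => j _; rewrite -sumrB; apply: eq_bigr => k _.
  by rewrite mulrBl.
have t0 j k : 0 <= (u j + v k - m j * p k) * r j k by rewrite mulr_ge0 // subr_ge0.
split.
  by rewrite -subr_ge0 E; apply: sumr_ge0 => j _; apply: sumr_ge0.
move=> e j k rjk.
have {}E : \sum_j \sum_k (u j + v k - m j * p k) * r j k = 0 by rewrite -E e subrr.
have := psumr_eq0P (fun j _ => sumr_ge0 _ (fun k _ => t0 j k)) E (i := j) isT.
move/(psumr_eq0P (fun k _ => t0 j k))/(_ k isT)/eqP.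
rewrite mulf_eq0 (negPf rjk) orbF subr_eq0 => /eqP e'.
exact: uve.
Qed.

End Rearrangement.

(** * Phase factors on the unit circle *)

Section PhaseFactors.
Context {R : realType}.
Implicit Types (a b : R) (z : R[i]).

Definition cis a : R[i] := cos a +i* sin a.

Lemma cisD a b : cis (a + b) = cis a * cis b.
Proof. by rewrite /cis cosD sinD; congr (_ +i* _); rewrite addrC. Qed.

Lemma cis0 : cis 0 = 1. Proof. by rewrite /cis cos0 sin0. Qed.

Lemma conj_cis a : Num.conj (cis a) = cis (- a).
Proof. by rewrite /cis cosN sinN. Qed.

Lemma normc_cis a : Normc.normc (cis a) = 1.
Proof. by rewrite /= cos2Dsin2 sqrtr1. Qed.

Lemma cis_inj a b : cis a = cis b -> `|a - b| < pi *+ 2 -> a = b.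
Proof.
move=> [ec es] ab.
have := cos2Dsin2 b; rewrite !expr2 -{1}ec -{1}es -cosB -cos_norm => c1.
have p0 := @pi_gt0 R.
apply/eqP; rewrite -subr_eq0 -normr_eq0; apply/eqP.
have [h|h] := leP `|a - b| pi.
  apply: (@cos_inj R); rewrite ?in_itv/=.
  - by rewrite h normr_ge0.
  - by rewrite lexx ltW.
  by rewrite c1 cos0.
have : pi *+ 2 - `|a - b| = 0; last by lra.
apply: (@cos_inj R); rewrite ?in_itv/=; [apply/andP; split; lra|by rewrite lexx ltW|].
by rewrite cos0 -c1 -[RHS]cosN -[RHS]cosD2pi addrC.
Qed.

Lemma cis_exists z : Normc.normc z = 1 -> exists2 a, `|a| <= pi & cis a = z.
Proof.
case: z => x y /= /(congr1 (fun r => r ^+ 2)); rewrite expr1n sqr_sqrtr ?addr_ge0 ?sqr_ge0 // => xy.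
have x1 : -1 <= x <= 1.
  by rewrite -ler_norml -(@ler_pXn2r _ 2) ?nnegrE// expr1n real_normK ?num_real//; have := sqr_ge0 y; lra.
have sy : Num.sqrt (1 - x ^+ 2) = `|y| by rewrite -sqrtr_sqr; congr Num.sqrt; lra.
have a0 := acos_ge0 x1; have ap := acos_lepi x1.
have [y0|y0] := leP 0 y.
  exists (acos x); first by rewrite ger0_norm.
  by rewrite /cis acosK ?in_itv//= sin_acos // sy ger0_norm.
exists (- acos x); first by rewrite normrN ger0_norm.
by rewrite /cis cosN sinN acosK ?in_itv//= sin_acos // sy ltr0_norm // opprK.
Qed.

Lemma cos_gt0_abs a : `|a| < pi -> 0 < cos a -> `|a| < pi / 2.
Proof.
rewrite -(cos_norm a) => ap c0; rewrite ltNge; apply/negP => h.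
have := @ler_cos R (pi / 2) `|a|; rewrite cos_pihalf; have := @pi_gt0 R => p0.
by move=> /(_ _ h (ltW ap)) H; have := H _; rewrite leNgt => /(_ _)/negP; apply=> //; lra.
Qed.

Lemma abs_le_of_cos a b : `|a| <= pi -> 0 <= b <= pi -> cos b <= cos a -> `|a| <= b.
Proof.
move=> ap /andP[b0 bp]; rewrite -(cos_norm a) => ba; rewrite leNgt; apply/negP => h.
by move: ba; rewrite leNgt ltr_cos ?in_itv/= ?normr_ge0 ?b0 ?h.
Qed.

(* Two points of the closed unit disc with real part at least [cos A] subtend
   an angle of at most [2 A] at the origin. *)
Lemma cos_ratio_ge (p q : R[i]) (psi c : R) : p = cis psi * q ->
  0 < c -> c <= complex.Re p -> c <= complex.Re q -> complex.Re q ^+ 2 + complex.Im q ^+ 2 <= 1 ->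
  2 * c ^+ 2 - 1 <= cos psi.
Proof.
case: p q => p1 p2 [q1 q2] [e1 e2] /= c0 c1 c2 r1.
have := cos2Dsin2 psi; move: (cos psi) (sin psi) e1 e2 => co si e1 e2 cs.
have r0 : 0 < q1 ^+ 2 + q2 ^+ 2 by have := sqr_ge0 q2; nra.
have E1 : co * (q1 ^+ 2 + q2 ^+ 2) = p1 * q1 + p2 * q2 by rewrite e1 e2; ring.
have E2 : p1 ^+ 2 + p2 ^+ 2 = q1 ^+ 2 + q2 ^+ 2.
  have -> : p1 ^+ 2 + p2 ^+ 2 = (co ^+ 2 + si ^+ 2) * (q1 ^+ 2 + q2 ^+ 2) by rewrite e1 e2; ring.
  by rewrite cs mul1r.
set r := q1 ^+ 2 + q2 ^+ 2 in r0 r1 E1 E2 *.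
have h1 : c ^+ 2 <= p1 * q1 by nra.
(* Since |p|^2 = |q|^2 = r, both p2^2 and q2^2 are at most r - c^2. *)
have h2 : c ^+ 2 - r <= p2 * q2.
  have : 0 <= (p2 + q2) ^+ 2 by apply: sqr_ge0.
  have : c ^+ 2 <= p1 ^+ 2 by nra.
  have : c ^+ 2 <= q1 ^+ 2 by nra.
  rewrite /r in E2 *; nra.
have h3 : 2 * c ^+ 2 - r <= co * r by lra.
rewrite -(ler_pM2r r0); have := sqr_ge0 c; nra.
Qed.

End PhaseFactors.

(** * Spectral decompositions in unitary frames *)

HB.lock Definition udiag {R : realType} {n : nat} (v : 'M[R[i]]_n) (d : 'rV[R[i]]_n) : 'M[R[i]]_n :=
  v *m diag_mx d *m map_mx Num.conj v^T.

(** The squared modulus of the inner product of column j of [w] with column k of [v]. For unitary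
    [w] and [v] these numbers form a doubly stochastic matrix, and the trace of a product of two
    diagonalized matrices becomes a double sum weighted by them. *)
HB.lock Definition overlap {R : realType} {n : nat} (w v : 'M[R[i]]_n) (j k : 'I_n) : R :=
  Normc.normc ((map_mx Num.conj w^T *m v) j k) ^+ 2.

Section Diagonalization.
Local Open Scope sesquilinear_scope.
Context {R : realType} {n : nat}.
Local Notation C := R[i].
Implicit Types (v w N : 'M[C]_n) (d e : 'rV[C]_n) (p q : 'rV[R]_n).

(** For unitary [v], [hdiag v p] is Hermitian and [cisdiag v p] is its exponential e^{i.}: logarithm
    and exponential keep the frame and change only the diagonal. *)
Definition hdiag v p := udiag v (map_mx (real_complex R) p).
Definition cisdiag v p := udiag v (map_mx cis p).

Lemma udiag_def v d : udiag v d = v *m diag_mx d *m v^t*.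
Proof. by rewrite udiag.unlock. Qed.

Lemma normcJE (z : C) : ((Normc.normc z ^+ 2)%:C = z * Num.conj z).
Proof. by rewrite -normCK rmorphXn. Qed.

Lemma unitary_adj v : v \is unitarymx -> v^t* \is unitarymx.
Proof. by rewrite trmxC_unitary. Qed.

Lemma mulmx_adj v : v \is unitarymx -> v *m v^t* = 1%:M.
Proof. by move/unitarymxP. Qed.

Lemma adj_mulmx v : v \is unitarymx -> v^t* *m v = 1%:M.
Proof. by move=> /unitary_adj/unitarymxP; rewrite trmxCK. Qed.

Lemma adjM v w : (v *m w)^t* = w^t* *m v^t*.
Proof. by rewrite trmx_mul map_mxM. Qed.

Lemma udiagE v d i j : udiag v d i j = \sum_k v i k * d 0 k * Num.conj (v j k).
Proof.
rewrite !udiag_def mxE; apply: eq_bigr => k _; rewrite !mxE; congr (_ * _).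
by rewrite (bigD1 k)//= !mxE eqxx mulr1n big1 ?addr0 // => l lk; rewrite !mxE (negPf lk) mulr0n mulr0.
Qed.

Lemma udiag_adj v d : (udiag v d)^t* = udiag v (map_mx Num.conj d).
Proof. by rewrite !udiag_def !adjM trmxCK tr_diag_mx map_diag_mx mulmxA. Qed.

Lemma udiagM v d e : v \is unitarymx ->
  udiag v d *m udiag v e = udiag v (\row_k (d 0 k * e 0 k)).
Proof.
move=> vu; rewrite !udiag_def !mulmxA -(mulmxA _ (v^t*)) adj_mulmx // mulmx1.
by rewrite -(mulmxA v) mulmx_diag.
Qed.

Lemma udiag1 v : v \is unitarymx -> udiag v (const_mx 1) = 1%:M.
Proof. by move=> vu; rewrite !udiag_def diag_const_mx mulmx1 mulmx_adj. Qed.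

Lemma udiag_conj w v d : w *m udiag v d *m w^t* = udiag (w *m v) d.
Proof. by rewrite !udiag_def adjM !mulmxA. Qed.

Lemma udiagZ v (a : C) d : a *: udiag v d = udiag v (a *: d).
Proof. by rewrite !udiag_def linearZ/= -scalemxAr -scalemxAl. Qed.

Lemma udiagD v d e : udiag v d + udiag v e = udiag v (d + e).
Proof. by rewrite !udiag_def raddfD mulmxDr mulmxDl. Qed.

Lemma overlapE w v j k : (overlap w v j k)%:C = (w^t* *m v) j k * Num.conj ((w^t* *m v) j k).
Proof. by rewrite overlap.unlock normcJE. Qed.

Lemma overlap_ge0 w v j k : 0 <= overlap w v j k.
Proof. by rewrite overlap.unlock sqr_ge0. Qed.

Lemma trace_udiag w d N :
  \tr (udiag w d *m N) = \sum_j d 0 j * (w^t* *m N *m w) j j.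
Proof.
rewrite !udiag_def -!mulmxA mxtrace_mulC -!mulmxA /mxtrace; apply: eq_bigr => j _.
by rewrite mul_diag_mx mxE !mulmxA.
Qed.

Lemma compress_udiag w v d k :
  (w^t* *m udiag v d *m w) k k = \sum_j d 0 j * (overlap w v k j)%:C.
Proof.
have -> : w^t* *m udiag v d *m w = udiag (w^t* *m v) d.
  by rewrite -udiag_conj trmxCK.
rewrite udiagE; apply: eq_bigr => j _; rewrite overlapE; ring.
Qed.

Lemma trace_udiag2 w v d e :
  \tr (udiag w d *m udiag v e) =
  \sum_j \sum_k d 0 j * e 0 k * (overlap w v j k)%:C.
Proof.
rewrite trace_udiag; apply: eq_bigr => j _.
by rewrite compress_udiag mulr_sumr; apply: eq_bigr => k _; rewrite mulrA.
Qed.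

Lemma overlapC w v j k : overlap w v j k = overlap v w k j.
Proof.
apply: complexI; rewrite !overlapE.
have -> : (w^t* *m v) j k = Num.conj ((v^t* *m w) k j).
  by rewrite -{1}(trmxCK v) -adjM !mxE.
by rewrite conjCK mulrC.
Qed.

Lemma overlap_sumr w v j : w \is unitarymx -> v \is unitarymx -> \sum_k overlap w v j k = 1.
Proof.
move=> wu vu; apply: complexI; rewrite rmorph_sum/=.
transitivity ((w^t* *m udiag v (const_mx 1) *m w) j j).
  by rewrite compress_udiag; apply: eq_bigr => k _; rewrite mxE mul1r.
by rewrite udiag1 // mulmx1 adj_mulmx // mxE eqxx.
Qed.

Lemma overlap_suml w v k : w \is unitarymx -> v \is unitarymx -> \sum_j overlap w v j k = 1.
Proof. by move=> wu vu; under eq_bigr do rewrite overlapC; exact: overlap_sumr. Qed.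

Lemma compress_mull w d N k : w \is unitarymx ->
  (w^t* *m (udiag w d *m N) *m w) k k = d 0 k * (w^t* *m N *m w) k k.
Proof.
move=> wu; rewrite !udiag_def; move: (adj_mulmx wu); move: (w^t*) => W Ww.
by rewrite !mulmxA Ww mul1mx -!mulmxA mul_diag_mx mxE.
Qed.

Lemma compress_mulr w d N k : w \is unitarymx ->
  (w^t* *m (N *m udiag w d) *m w) k k = d 0 k * (w^t* *m N *m w) k k.
Proof.
move=> wu; rewrite !udiag_def; move: (adj_mulmx wu); move: (w^t*) => W Ww.
by rewrite !mulmxA -(mulmxA _ W w) Ww mulmx1 mul_mx_diag mxE mulrC.
Qed.

Lemma overlap_le1 w v j k : w \is unitarymx -> v \is unitarymx -> overlap w v j k <= 1.
Proof.
move=> wu vu; rewrite -(overlap_sumr j wu vu) (bigD1 k)//= lerDl.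
by apply: sumr_ge0 => *; exact: overlap_ge0.
Qed.

(** Read in the two frames, with q = w^* N v, the relation says q_jk d_k = e_j q_jk. It only
    constrains the pairs with q_jk nonzero, so it passes to any new diagonals that agree on those
    pairs. N = 1 makes functional calculus independent of the frame, and v = w gives its
    compatibility with commutation. *)
Lemma udiag_intertwine N v w d e d' e' : v \is unitarymx -> w \is unitarymx ->
  N *m udiag v d = udiag w e *m N ->
  (forall j k, (w^t* *m N *m v) j k != 0 -> e 0 j = d 0 k -> e' 0 j = d' 0 k) ->
  N *m udiag v d' = udiag w e' *m N.
Proof.
move=> vu wu H H'.
have red f g : N *m udiag v f = udiag w g *m N <->
    (w^t* *m N *m v) *m diag_mx f = diag_mx g *m (w^t* *m N *m v).
  rewrite !udiag_def; move: (adj_mulmx vu) (mulmx_adj vu) (adj_mulmx wu) (mulmx_adj wu).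
  move: (v^t*) (w^t*) => V W Vv vV Ww wW; split=> E.
    have := congr1 (fun M => W *m M *m v) E.
    by rewrite !mulmxA Ww mul1mx -(mulmxA _ V) Vv mulmx1 => ->.
  have := congr1 (fun M => w *m M *m V) E.
  by rewrite !mulmxA wW mul1mx -[_ *m v *m V]mulmxA vV mulmx1 -!mulmxA => ->.
apply/red; move/red/matrixP: H => H; apply/matrixP => j k.
have := H j k; rewrite !mul_diag_mx !mul_mx_diag mxE [RHS]mxE => E.
rewrite mxE [RHS]mxE.
have [->|q0] := eqVneq ((w^t* *m N *m v) j k) 0; first by rewrite mul0r mulr0.
by rewrite (H' j k) 1?mulrC//; apply: (mulIf q0); rewrite -E mulrC.
Qed.

Lemma udiag_change v w d e d' e' : v \is unitarymx -> w \is unitarymx ->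
  udiag v d = udiag w e -> (forall j k, e 0 j = d 0 k -> e' 0 j = d' 0 k) ->
  udiag v d' = udiag w e'.
Proof.
move=> vu wu H H'; rewrite -[LHS]mul1mx -[RHS]mulmx1.
by apply: (udiag_intertwine (d := d) (e := e)); rewrite ?mul1mx ?mulmx1// => j k _; exact: H'.
Qed.

Lemma udiag_comm N v d d' : v \is unitarymx -> comm_mx N (udiag v d) ->
  (forall j k, d 0 j = d 0 k -> d' 0 j = d' 0 k) -> comm_mx N (udiag v d').
Proof. by move=> vu H H'; apply: (udiag_intertwine (d := d) (e := d)) => // j k _; exact: H'. Qed.

Lemma normal_udiag N : N \is normalmx -> exists v d, v \is unitarymx /\ N = udiag v d.
Proof.
move=> /orthomx_spectralP ->; have su := spectral_unitarymx N.
exists ((spectralmx N)^t*), (spectral_diag N); split; first exact: unitary_adj.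
by rewrite !udiag_def trmxCK invmx_unitary.
Qed.

Lemma hermsymmxP N : reflect (N^t* = N) (N \is hermsymmx).
Proof. by apply: (iffP (is_hermitianmxP _ _ _)); rewrite expr0 scale1r => /esym. Qed.

Lemma udiag_inj v d e : v \is unitarymx -> udiag v d = udiag v e -> d = e.
Proof.
move=> vu H; apply/rowP => k.
have := congr1 (fun M => (v^t* *m M *m v) k k) H.
rewrite !udiag_def; move: (adj_mulmx vu); move: (v^t*) => V Vv.
by rewrite !mulmxA Vv !mul1mx -!(mulmxA _ V) Vv !mulmx1 !mxE eqxx !mulr1n.
Qed.

Lemma hermitian_hdiag N : N \is hermsymmx -> exists v p, v \is unitarymx /\ N = hdiag v p.
Proof.
move=> Nh; have [v [d [vu E]]] := normal_udiag (hermitian_normalmx Nh).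
move/hermsymmxP: Nh; rewrite E udiag_adj => /(udiag_inj vu)/rowP dr.
exists v, (\row_k complex.Re (d 0 k)); split=> //; congr udiag; apply/rowP => k; rewrite !mxE.
have := dr k; rewrite mxE => /CrealP/complex_realP [a ->]; by [].
Qed.

Lemma unitary_cisdiag N : N \is unitarymx ->
  exists v p, [/\ v \is unitarymx, N = cisdiag v p & forall k, `|p 0 k| <= pi].
Proof.
move=> Nu; have Nn : N \is normalmx by apply/normalmxP; rewrite mulmx_adj // adj_mulmx.
have [v [d [vu E]]] := normal_udiag Nn.
have d1 k : exists2 a, `|a| <= pi & cis a = d 0 k.
  apply: cis_exists; have := mulmx_adj Nu.
  rewrite E udiag_adj udiagM // -(udiag1 vu) => /(udiag_inj vu)/rowP/(_ k); rewrite !mxE.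
  rewrite -normcJE => /complexI/eqP; rewrite sqrf_eq1 => /orP[/eqP//|/eqP h].
  have : 0 <= Normc.normc (d 0 k) by case: (d 0 k) => ? ?; exact: sqrtr_ge0.
  by rewrite h; lra.
have /choice[f Hf] : forall k, exists a, `|a| <= pi /\ cis a = d 0 k.
  by move=> k; have [a] := d1 k; exists a.
exists v, (\row_k f k); split=> //; last by move=> k; rewrite mxE; have [] := Hf k.
by rewrite E; congr udiag; apply/rowP => k; rewrite !mxE; have [] := Hf k.
Qed.

Lemma row_sort p : exists s : 'S_n, {homo (fun k => p 0 (s k)) : j k / (j <= k)%N >-> k <= j}.
Proof.
pose l := [tuple p 0 k | k < n].
have /tuple_permP[s E] : perm_eq (sort >=%R l) l by rewrite perm_sort.
exists s => j k jk.
have nE i : p 0 (s i) = nth 0 (sort >=%R l) i.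
  by rewrite E -tnth_nth !tnth_mktuple.
rewrite !nE; apply: (@sorted_leq_nth _ >=%R) => //.
- by move=> x y z xy yz; exact: le_trans yz xy.
- by move=> x; exact: lexx.
- by apply: sort_sorted => x y; exact: le_total.
- by rewrite inE size_sort size_tuple.
- by rewrite inE size_sort size_tuple.
Qed.

Lemma udiag_perm (s : 'S_n) v : v \is unitarymx ->
  exists2 w, w \is unitarymx & forall d, udiag v d = udiag w (\row_k d 0 (s k)).
Proof.
move=> vu; exists (col_perm s v).
  have E : udiag (col_perm s v) (const_mx 1) = udiag v (const_mx 1).
    apply/matrixP => i j; rewrite !udiagE [RHS](reindex_perm s)/=.
    by apply: eq_bigr => k _; rewrite !mxE.
  by apply/unitarymxP; rewrite -(udiag1 vu) -E !udiag_def diag_const_mx mulmx1.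
move=> d; apply/matrixP => i j; rewrite !udiagE (reindex_perm s)/=.
by apply: eq_bigr => k _; rewrite !mxE.
Qed.

Lemma char_poly_udiag v d : v \is unitarymx ->
  char_poly (udiag v d) = \prod_k ('X - (d 0 k)%:P).
Proof.
move=> vu.
have E : char_poly_mx (udiag v d) =
    map_mx polyC v *m char_poly_mx (diag_mx d) *m map_mx polyC (v^t*).
  rewrite /char_poly_mx udiag_def mulmxBr mulmxBl -!map_mxM; congr (_ - _).
  by rewrite scalar_mxC -mulmxA -map_mxM mulmx_adj // map_mx1 mulmx1.
rewrite /char_poly E !det_mulmx mulrC mulrA -det_mulmx -map_mxM adj_mulmx //.
rewrite map_mx1 det1 mul1r -/(char_poly _) char_poly_trig ?diag_mx_is_trig //.
by apply: eq_bigr => k _; rewrite mxE eqxx mulr1n.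
Qed.

Lemma hdiag_hermitian v p : hdiag v p \is hermsymmx.
Proof.
apply/hermsymmxP; rewrite udiag_adj; congr udiag; apply/rowP => k; rewrite !mxE.
by apply/CrealP/complex_realP; exists (p 0 k).
Qed.

Lemma hermitian_hdiag_of_char_poly N p : N \is hermsymmx ->
  char_poly N = \prod_(k < n) ('X - ((p 0 k)%:C)%:P) ->
  exists2 v, v \is unitarymx & N = hdiag v p.
Proof.
move=> /hermitian_hdiag[v [q [vu ->]]]; rewrite char_poly_udiag // => E.
have /tuple_permP[s Es] : perm_eq [tuple (p 0 k)%:C | k < n] [tuple (q 0 k)%:C | k < n].
  apply: prod_XsubC_eq; rewrite !big_tuple.
  under eq_bigr do rewrite tnth_mktuple.
  under [RHS]eq_bigr do rewrite tnth_mktuple.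
  by rewrite -E; apply: eq_bigr => k _; rewrite mxE.
have [w wu /(_ (map_mx (real_complex R) q)) Ew] := udiag_perm s vu.
exists w => //; rewrite /hdiag Ew; congr udiag; apply/rowP => k; rewrite !mxE.
have := congr1 (fun l => nth 0 l k) Es.
by rewrite -!tnth_nth !tnth_mktuple.
Qed.

Lemma unitary_cisdiag_sorted N : N \is unitarymx ->
  exists v p, [/\ v \is unitarymx, N = cisdiag v p, forall k, `|p 0 k| <= pi &
    {homo (fun k : 'I_n => p 0 k) : j k / (j <= k)%N >-> k <= j}].
Proof.
move=> /unitary_cisdiag[v [p [vu E pp]]].
have [s Hs] := row_sort p; have [w wu Ew] := udiag_perm s vu.
exists w, (\row_k p 0 (s k)); split=> // [|k|j k jk]; last 2 first.
- by rewrite mxE.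
- by rewrite !mxE; exact: Hs.
by rewrite E /cisdiag Ew; congr udiag; apply/rowP => k; rewrite !mxE.
Qed.

Lemma cisdiagD v p q : v \is unitarymx -> cisdiag v (p + q) = cisdiag v p *m cisdiag v q.
Proof. by move=> vu; rewrite /cisdiag udiagM //; congr udiag; apply/rowP => k; rewrite !mxE cisD. Qed.

Lemma cisdiag0 v : v \is unitarymx -> cisdiag v 0 = 1%:M.
Proof. by move=> vu; rewrite -(udiag1 vu); congr udiag; apply/rowP => k; rewrite !mxE cis0. Qed.

Lemma cisdiag_adj v p : (cisdiag v p)^t* = cisdiag v (- p).
Proof. by rewrite /cisdiag udiag_adj; congr udiag; apply/rowP => k; rewrite !mxE conj_cis. Qed.

Lemma cisdiag_unitary v p : v \is unitarymx -> cisdiag v p \is unitarymx.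
Proof. by move=> vu; apply/unitarymxP; rewrite cisdiag_adj -cisdiagD // subrr cisdiag0. Qed.

End Diagonalization.

(** * Weighted phase sums under multiplication of unitary matrices *)

Section PhaseSums.
Local Open Scope sesquilinear_scope.
Context {R : realType} {n : nat}.
Local Notation C := R[i].
Implicit Types (v w g : 'M[C]_n) (p q b : 'rV[R]_n).

Definition noninc_row p := {homo (fun k : 'I_n => p 0 k) : j k / (j <= k)%N >-> k <= j}.

Definition wsum (mu p : 'rV[R]_n) : R := \sum_k mu 0 k * p 0 k.

Lemma wsumZ mu p (a : R) : wsum mu (a *: p) = a * wsum mu p.
Proof. by rewrite /wsum mulr_sumr; apply: eq_bigr => k _; rewrite mxE; ring. Qed.

(** The double sum is the trace of [hdiag w mu *m hdiag v p], so this is von Neumann's trace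
    inequality. In the equality case only columns with equal entries of [p] overlap, which makes [w]
    a frame for the same Hermitian matrix. *)
Lemma overlap_rearrangement (mu p : 'rV[R]_n) w v :
  w \is unitarymx -> v \is unitarymx ->
  (forall j k : 'I_n, (j < k)%N -> mu 0 k < mu 0 j) -> noninc_row p ->
  \sum_j \sum_k mu 0 j * p 0 k * overlap w v j k <= wsum mu p /\
  (\sum_j \sum_k mu 0 j * p 0 k * overlap w v j k = wsum mu p -> hdiag v p = hdiag w p).
Proof.
move=> wu vu mudec pdec.
have [le eq] := @doubly_stochastic_rearrangement _ n (fun k => mu 0 k) (fun k => p 0 k)
  (overlap w v) mudec pdec (overlap_ge0 w v) (fun j => overlap_sumr j wu vu) (fun k => overlap_suml k wu vu).
split=> // /eq H; rewrite -[LHS]mul1mx -[RHS]mulmx1.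
(* Intertwining by the identity, with constant diagonals to start from, leaves just the condition on
   the support of w^* v. *)
apply: (udiag_intertwine (d := const_mx 1) (e := const_mx 1)) => //.
  by rewrite !udiag1 // mulmx1.
move=> j k; rewrite mulmx1 !mxE => q0 _; congr (_%:C); apply: H.
rewrite -(inj_eq (@complexI R)) overlapE mulf_neq0 ?conjC_eq0 //; by rewrite !mxE.
Qed.

(* Both sides are tr (hdiag w a * W^* * U), where W = G U, so that W^* U = W^* G^* W,
   and W commutes with hdiag w a. *)
Lemma weighted_trace_step w v g p q b (a : 'rV[R]_n) :
  w \is unitarymx -> v \is unitarymx -> g \is unitarymx ->
  cisdiag w q = cisdiag g b *m cisdiag v p ->
  \sum_j \sum_k (a 0 j)%:C * cis (p 0 k - q 0 j) * (overlap w v j k)%:C =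
  \sum_j \sum_k (a 0 j)%:C * cis (- b 0 k) * (overlap w g j k)%:C.
Proof.
move=> wu vu gu E.
transitivity (\tr (hdiag w a *m cisdiag w (- q) *m cisdiag v p)).
  rewrite /hdiag {1}/cisdiag udiagM // trace_udiag2.
  by apply: eq_bigr => j _; apply: eq_bigr => k _; rewrite !mxE addrC cisD mulrA.
have -> : cisdiag v p = cisdiag g (- b) *m cisdiag w q.
  by rewrite E mulmxA -cisdiagD // addNr cisdiag0 // mul1mx.
rewrite mulmxA mxtrace_mulC !mulmxA.
have -> : cisdiag w q *m hdiag w a = hdiag w a *m cisdiag w q.
  by rewrite /cisdiag /hdiag !udiagM //; congr udiag; apply/rowP => k; rewrite !mxE mulrC.
rewrite -(mulmxA (hdiag w a)) -cisdiagD // subrr cisdiag0 // mulmx1 trace_udiag2.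
by apply: eq_bigr => j _; apply: eq_bigr => k _; rewrite !mxE.
Qed.

Lemma Re_sum (I : finType) (f : I -> C) : complex.Re (\sum_i f i) = \sum_i complex.Re (f i).
Proof. by apply: (big_morph (@complex.Re R)) => [[? ?] [? ?]|]. Qed.

Lemma Im_sum (I : finType) (f : I -> C) : complex.Im (\sum_i f i) = \sum_i complex.Im (f i).
Proof. by apply: (big_morph (@complex.Im R)) => [[? ?] [? ?]|]. Qed.

(** Real part of the trace identity with all weights 1. The overlaps with [g] sum out, so the total
    of 1 - cos over all pairs depends on [b] alone and is quadratic in it; this controls the error
    of a step. *)
Lemma weighted_cos_step w v g p q b :
  w \is unitarymx -> v \is unitarymx -> g \is unitarymx ->
  cisdiag w q = cisdiag g b *m cisdiag v p ->
  \sum_j \sum_k cos (p 0 k - q 0 j) * overlap w v j k = \sum_k cos (b 0 k).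
Proof.
move=> wu vu gu E.
have := congr1 (@complex.Re R) (weighted_trace_step (const_mx 1) wu vu gu E).
rewrite !Re_sum => H; transitivity (\sum_j \sum_k cos (b 0 k) * overlap w g j k).
  transitivity (\sum_(i < n) complex.Re (\sum_k
      ((const_mx 1 : 'rV[R]_n) 0 i)%:C * cis (p 0 k - q 0 i) * (overlap w v i k)%:C)).
    apply: eq_bigr => j _; rewrite Re_sum; apply: eq_bigr => k _.
    by rewrite !mxE /=; ring.
  rewrite H; apply: eq_bigr => j _; rewrite Re_sum; apply: eq_bigr => k _.
  by rewrite !mxE /= cosN; ring.
rewrite exchange_big/=; apply: eq_bigr => k _.
by rewrite -mulr_sumr overlap_suml // mulr1.
Qed.

(** Imaginary part of the trace identity with the weights kept: the first-order term of a step. *)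
Lemma weighted_sin_step w v g p q b (a : 'rV[R]_n) :
  w \is unitarymx -> v \is unitarymx -> g \is unitarymx ->
  cisdiag w q = cisdiag g b *m cisdiag v p ->
  \sum_j \sum_k a 0 j * sin (p 0 k - q 0 j) * overlap w v j k =
  - \sum_j \sum_k a 0 j * sin (b 0 k) * overlap w g j k.
Proof.
move=> wu vu gu E.
have := congr1 (@complex.Im R) (weighted_trace_step a wu vu gu E).
rewrite !Im_sum => H.
transitivity (\sum_(i < n) complex.Im (\sum_k (a 0 i)%:C * cis (p 0 k - q 0 i) * (overlap w v i k)%:C)).
  apply: eq_bigr => j _; rewrite Im_sum; apply: eq_bigr => k _.
  by rewrite /=; ring.
rewrite H -sumrN; apply: eq_bigr => j _; rewrite Im_sum -sumrN; apply: eq_bigr => k _.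
by rewrite /= sinN; ring.
Qed.

Variable mu : 'rV[R]_n.
Hypothesis mudec : forall j k : 'I_n, (j < k)%N -> mu 0 k < mu 0 j.

(** The end frame [w] is a competitor in the rearrangement inequality for the starting phases [p].
    The differences [p 0 k - q 0 j] need not be small for small h, only bounded by [D]: pairs far
    apart are paid for by 1 - cos, so crossings do no harm, and [K] depends on [mu] and [D]
    alone. *)
Lemma wsum_step (D : R) : D < pi *+ 2 ->
  exists2 K, 0 <= K & forall w v g p q b (h : R),
    w \is unitarymx -> v \is unitarymx -> g \is unitarymx ->
    noninc_row p -> (forall j k, `|p 0 k - q 0 j| <= D) ->
    cisdiag w q = cisdiag g (h *: b) *m cisdiag v p ->
    wsum mu q - h * (\sum_j \sum_k mu 0 j * b 0 k * overlap w g j k)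
      - K * h ^+ 2 * (\sum_k b 0 k ^+ 2) <= wsum mu p.
Proof.
move=> D2; have [K0 K00 HK] := normB_sin_le_cos D2.
pose m1 : R := \sum_j `|mu 0 j|.
have m10 : 0 <= m1 by apply: sumr_ge0.
have m1j j : `|mu 0 j| <= m1.
  by rewrite /m1 (bigD1 j)//= lerDl; apply: sumr_ge0.
(* [K0 / 2] pays for replacing phase differences by their sines, through 1 - cos x <= x^2 / 2; the 1
   pays for replacing h b_k by its sine. *)
exists (m1 * (K0 / 2 + 1)); first by rewrite mulr_ge0 // addr_ge0 // divr_ge0.
move=> w v g p q b h wu vu gu pdec pq E.
have [le1 _] := overlap_rearrangement wu vu mudec pdec.
have qE : wsum mu q = \sum_j \sum_k mu 0 j * q 0 j * overlap w v j k.
  by apply: eq_bigr => j _; rewrite -mulr_sumr overlap_sumr // mulr1.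
have cE := weighted_cos_step wu vu gu E.
have sE := weighted_sin_step mu wu vu gu E.
have B1 : `|\sum_j \sum_k mu 0 j * (p 0 k - q 0 j - sin (p 0 k - q 0 j)) * overlap w v j k|
     <= m1 * K0 * (h ^+ 2 / 2 * \sum_k b 0 k ^+ 2).
  apply: (@le_trans _ _ (m1 * K0 * \sum_j \sum_k (1 - cos (p 0 k - q 0 j)) * overlap w v j k)).
    apply: le_trans (ler_norm_sum _ _ _) _; rewrite mulr_sumr; apply: ler_sum => j _.
    apply: le_trans (ler_norm_sum _ _ _) _; rewrite mulr_sumr; apply: ler_sum => k _.
    rewrite normrM [X in X * _]normrM (ger0_norm (overlap_ge0 w v j k)) mulrA ler_wpM2r ?overlap_ge0 //.
    by rewrite -mulrA ler_pM // HK.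
  rewrite ler_wpM2l ?mulr_ge0 //.
  have -> : \sum_j \sum_k (1 - cos (p 0 k - q 0 j)) * overlap w v j k =
      \sum_k (1 - cos ((h *: b) 0 k)).
    rewrite [RHS]sumrB -cE.
    have -> : \sum_(k < n) (1 : R) = \sum_(j < n) \sum_k overlap w v j k.
      by apply: eq_bigr => j _; rewrite overlap_sumr.
    rewrite -sumrB; apply: eq_bigr => j _; rewrite -sumrB; apply: eq_bigr => k _.
    by rewrite mulrBl mul1r.
  rewrite mulr_sumr; apply: ler_sum => k _; apply: le_trans (onem_cos_le _) _.
  by rewrite mxE exprMn; lra.
have B2 : `|\sum_j \sum_k mu 0 j * (h * b 0 k - sin (h * b 0 k)) * overlap w g j k|
     <= m1 * (h ^+ 2 * \sum_k b 0 k ^+ 2).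
  apply: (@le_trans _ _ (\sum_j \sum_k m1 * (h * b 0 k) ^+ 2 * overlap w g j k)).
    apply: le_trans (ler_norm_sum _ _ _) _; apply: ler_sum => j _.
    apply: le_trans (ler_norm_sum _ _ _) _; apply: ler_sum => k _.
    rewrite normrM [X in X * _]normrM (ger0_norm (overlap_ge0 w g j k)) ler_wpM2r ?overlap_ge0 //.
    by rewrite ler_pM // normB_sin_le.
  rewrite exchange_big/= mulrA mulr_sumr; apply: ler_sum => k _.
  by rewrite -mulr_sumr overlap_suml // mulr1 exprMn mulrA.
have E1 : \sum_j \sum_k mu 0 j * (p 0 k - q 0 j - sin (p 0 k - q 0 j)) * overlap w v j k =
    \sum_j \sum_k mu 0 j * p 0 k * overlap w v j k - wsum mu q
    - \sum_j \sum_k mu 0 j * sin (p 0 k - q 0 j) * overlap w v j k.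
  rewrite qE -!sumrB; apply: eq_bigr => j _; rewrite -!sumrB; apply: eq_bigr => k _; ring.
have E2 : \sum_j \sum_k mu 0 j * (h * b 0 k - sin (h * b 0 k)) * overlap w g j k =
    h * (\sum_j \sum_k mu 0 j * b 0 k * overlap w g j k)
    - \sum_j \sum_k mu 0 j * sin ((h *: b) 0 k) * overlap w g j k.
  rewrite mulr_sumr -!sumrB; apply: eq_bigr => j _; rewrite mulr_sumr -!sumrB; apply: eq_bigr => k _.
  by rewrite mxE; ring.
rewrite E1 sE in B1; rewrite E2 in B2.
move: B1 B2; rewrite !ler_norml => /andP[B1 _] /andP[B2 B2'].
lra.
Qed.

Lemma compress_cis w v p k :
  (w^t* *m cisdiag v p *m w) k k = \sum_j cis (p 0 j) * (overlap w v k j)%:C.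
Proof. by rewrite compress_udiag; apply: eq_bigr => j _; rewrite mxE. Qed.

(** A diagonal entry in a unitary frame is a point of the numerical range, a convex combination of
    the eigenvalues. *)
Lemma Re_compress_ge w v p k (A : R) : w \is unitarymx -> v \is unitarymx ->
  0 <= A <= pi -> (forall j, `|p 0 j| <= A) ->
  cos A <= complex.Re ((w^t* *m cisdiag v p *m w) k k).
Proof.
move=> wu vu A0 pA; rewrite compress_cis Re_sum.
have -> : cos A = \sum_j cos A * overlap w v k j by rewrite -mulr_sumr overlap_sumr // mulr1.
apply: ler_sum => j _ /=; rewrite mulr0 subr0 ler_wpM2r ?overlap_ge0 //.
exact: cos_abs_ge.
Qed.

Lemma normsq_compress_le1 w v p k : w \is unitarymx -> v \is unitarymx ->
  complex.Re ((w^t* *m cisdiag v p *m w) k k) ^+ 2 +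
  complex.Im ((w^t* *m cisdiag v p *m w) k k) ^+ 2 <= 1.
Proof.
move=> wu vu; set z := (_ *m _) k k.
have : `|z| <= 1.
  rewrite /z compress_cis; apply: le_trans (ler_norm_sum _ _ _) _.
  have -> : 1 = \sum_j (overlap w v k j)%:C by rewrite -rmorph_sum/= overlap_sumr.
  apply: ler_sum => j _; rewrite normrM.
  have -> : `|cis (p 0 j)| = (Normc.normc (cis (p 0 j)))%:C by [].
  by rewrite normc_cis mul1r ger0_norm // ler0c overlap_ge0.
move=> z1; rewrite -lecR add_Re2_Im2; exact: exprn_ile1.
Qed.

Lemma compress_mul w v g p q b k : w \is unitarymx -> v \is unitarymx -> g \is unitarymx ->
  cisdiag w q = cisdiag g b *m cisdiag v p ->
  (w^t* *m cisdiag v p *m w) k k = cis (q 0 k) * (w^t* *m cisdiag g (- b) *m w) k k.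
Proof.
move=> wu vu gu E.
have -> : cisdiag v p = cisdiag g (- b) *m cisdiag w q.
  by rewrite E mulmxA -cisdiagD // addNr cisdiag0 // mul1mx.
by rewrite {2}/cisdiag compress_mulr // mxE.
Qed.

(** On the k-th eigenvector of the product, the compression of e^{ip} is e^{i q_k} times that of
    e^{-ib}. Both compressions lie in the unit disc with real part at least cos A, so their angle is
    at most 2A; the bound |q_k| <= pi fixes the branch. *)
Lemma phase_bound (A : R) w v g p q b : 0 <= A -> A < pi / 2 ->
  w \is unitarymx -> v \is unitarymx -> g \is unitarymx ->
  (forall k, `|p 0 k| <= A) -> (forall k, `|b 0 k| <= A) -> (forall k, `|q 0 k| <= pi) ->
  cisdiag w q = cisdiag g b *m cisdiag v p ->
  forall k, `|q 0 k| <= 2 * A.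
Proof.
move=> A0 A2 wu vu gu pA bA qpi E k; have p0 := @pi_gt0 R.
have Ap : 0 <= A <= pi by apply/andP; split; lra.
have A2p : 0 <= 2 * A <= pi by apply/andP; split; lra.
apply: abs_le_of_cos A2p _; first exact: qpi.
have -> : cos (2 * A) = 2 * cos A ^+ 2 - 1.
  by rewrite mulr_natl cos_mulr2n mulr_natl.
apply: (cos_ratio_ge (compress_mul k wu vu gu E)).
- by apply: cos_gt0_pihalf; apply/andP; split; lra.
- exact: Re_compress_ge.
- by apply: Re_compress_ge => // j; rewrite mxE normrN.
- exact: normsq_compress_le1.
Qed.

(* On an eigenvector of [e^{i b}] for -1 the compressions of [e^{i p}] and of
   [e^{i b} e^{i p}] would be opposite, yet both have positive real part. *)
Lemma cis_quotient_neqN1 (A : R) w v g p q b k : 0 <= A -> A < pi / 2 ->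
  w \is unitarymx -> v \is unitarymx -> g \is unitarymx ->
  (forall k, `|p 0 k| <= A) -> (forall k, `|q 0 k| <= A) ->
  cisdiag w q = cisdiag g b *m cisdiag v p -> cis (b 0 k) != -1.
Proof.
move=> A0 A2 wu vu gu pA qA E; have p0 := @pi_gt0 R.
have Ap : 0 <= A <= pi by apply/andP; split; lra.
have cA : 0 < cos A by apply: cos_gt0_pihalf; apply/andP; split; lra.
have := Re_compress_ge k gu wu Ap qA; have := Re_compress_ge k gu vu Ap pA.
have -> : (g^t* *m cisdiag w q *m g) k k = cis (b 0 k) * (g^t* *m cisdiag v p *m g) k k.
  by rewrite E {1}/cisdiag compress_mull // mxE.
move=> h1 h2; apply/eqP => e; move: h2; rewrite e mulN1r.
case: (_ k k) h1 => z1 z2 /=; lra.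
Qed.

(** A step of length zero. It compares two lists of phases of one matrix without exhibiting a
    permutation between them. *)
Lemma wsum_ge_of_cisdiag_eq (D : R) v w p q : D < pi *+ 2 ->
  v \is unitarymx -> w \is unitarymx -> noninc_row p ->
  (forall j k, `|p 0 k - q 0 j| <= D) -> cisdiag w q = cisdiag v p ->
  wsum mu q <= wsum mu p.
Proof.
move=> D2 vu wu pdec pq E; have [K _ HK] := wsum_step D2.
have := HK w v v p q 0 0 wu vu vu pdec pq.
by rewrite scale0r cisdiag0 // mul1mx expr0n/= mulr0 !mul0r !subr0; apply.
Qed.

(* Along s |-> e^{is beta} e^{i phi} the first-order growth of the weighted phase sum
   is at most [wsum mu beta]; phases stay in [-2A, 2A], so no branch is crossed. *)
Lemma wsum_phase_subadditive (A : R) v w g p q b : 0 <= A -> A < pi / 2 ->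
  w \is unitarymx -> v \is unitarymx -> g \is unitarymx ->
  noninc_row p -> noninc_row b -> noninc_row q ->
  (forall k, `|p 0 k| <= A) -> (forall k, `|b 0 k| <= A) -> (forall k, `|q 0 k| <= 2 * A) ->
  cisdiag w q = cisdiag g b *m cisdiag v p ->
  wsum mu q <= wsum mu b + wsum mu p /\
  (wsum mu q = wsum mu b + wsum mu p -> comm_mx (cisdiag g b) (cisdiag v p)).
Proof.
move=> A0 A2 wu vu gu pdec bdec qdec pA bA qA E.
have D2 : 4 * A < pi *+ 2 by have := @pi_gt0 R; lra.
have dist (r r' : 'rV[R]_n) : (forall k, `|r 0 k| <= 2 * A) -> (forall k, `|r' 0 k| <= 2 * A) ->
    forall j k, `|r 0 k - r' 0 j| <= 4 * A.
  move=> rA r'A j k; apply: le_trans (ler_normB _ _) _.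
  by have := rA k; have := r'A j; lra.
have pA2 k : `|p 0 k| <= 2 * A by have := pA k; lra.
pose P s := cisdiag g (s *: b) *m cisdiag v p.
(* Decompositions are chosen for each s separately, with no continuity in s: the step estimate
   compares any two choices. *)
have /choice[V HV] s : exists vp : 'M[C]_n * 'rV[R]_n,
    [/\ vp.1 \is unitarymx, P s = cisdiag vp.1 vp.2, noninc_row vp.2 &
        0 <= s <= 1 -> forall k, `|vp.2 0 k| <= 2 * A].
  have [|v' [p' [v'u E' p'pi p'dec]]] := @unitary_cisdiag_sorted R n (P s).
    by apply: mul_unitarymx; exact: cisdiag_unitary.
  exists (v', p'); split=> //= /andP[s0 s1].
  have sbA k : `|(s *: b) 0 k| <= A.
    rewrite mxE normrM (ger0_norm s0); apply: le_trans (bA k).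
    by rewrite ler_piMl.
  exact: (phase_bound A0 A2 v'u vu gu pA sbA p'pi (esym E')).
have [K K0 HK] := wsum_step D2.
have step s h : P (s + h) = cisdiag g (h *: b) *m P s.
  by rewrite /P mulmxA -cisdiagD // -scalerDl addrC.
pose G s := wsum mu (V s).2 - s * wsum mu b.
have Gdec s t : 0 <= s -> s <= t -> t <= 1 -> G t <= G s.
  apply: (@nonincreasing_of_quadratic_steps _ G (K * \sum_k b 0 k ^+ 2)) => {s t} s h s0 h0 sh.
  have [v1 E1 d1 b1] := HV s; have [v2 E2 d2 b2] := HV (s + h).
  have s01 : 0 <= s <= 1 by apply/andP; split; lra.
  have sh01 : 0 <= s + h <= 1 by apply/andP; split; lra.
  have := HK _ _ g _ _ b h v2 v1 gu d1 (dist _ _ (b1 s01) (b2 sh01)).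
  rewrite -E1 -E2 -step => /(_ erefl).
  have [le _] := overlap_rearrangement v2 gu mudec bdec.
  have := ler_wpM2l h0 le; rewrite /G; lra.
have o01 : 0 <= (1 : R) <= 1 by rewrite ler01 lexx.
have z01 : 0 <= (0 : R) <= 1 by rewrite ler01 lexx.
have [v1 E1 d1 b1] := HV 1; have [v0 E0 d0 b0] := HV 0.
have q1 : wsum mu q <= wsum mu (V 1).2.
  apply: (wsum_ge_of_cisdiag_eq D2 v1 wu d1 (dist _ _ (b1 o01) qA)).
  by rewrite -E1 /P scale1r.
have q0 : wsum mu (V 0).2 <= wsum mu p.
  apply: (wsum_ge_of_cisdiag_eq D2 vu v0 pdec (dist _ _ pA2 (b0 z01))).
  by rewrite -E0 /P scale0r cisdiag0 // mul1mx.
have G0 s : 0 <= s <= 1 -> G s <= wsum mu p.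
  move=> /andP[s0 s1]; have := Gdec 0 s (lexx _) s0 s1; rewrite {2}/G mul0r subr0; lra.
split; first by have := G0 1 o01; rewrite /G mul1r; lra.
move=> eq.
have [le eqH] := overlap_rearrangement wu gu mudec bdec.
(* Equality makes the bound on G sharp at s = 1. A last step from 1 - h to 1, tested in the frame
   [w], then gives wsum mu b <= S + K B h for every small h. *)
have ge : wsum mu b <= \sum_j \sum_k mu 0 j * b 0 k * overlap w g j k.
  set S := \sum_j _ in le *; set B := \sum_k b 0 k ^+ 2 in Gdec.
  have B0 : 0 <= B by apply: sumr_ge0 => k _; exact: sqr_ge0.
  have main h : 0 < h -> h <= 1 -> wsum mu b <= S + K * B * h.
    move=> h0 h1.
    have h01 : 0 <= 1 - h <= 1 by apply/andP; split; lra.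
    have [vh Eh dh bh] := HV (1 - h).
    have := HK _ _ g _ _ b h wu vh gu dh (dist _ _ (bh h01) qA).
    rewrite -Eh E -step subrK /P scale1r => /(_ erefl).
    have := G0 _ h01; rewrite /G eq -/S -/B => g1 g2.
    rewrite -(ler_pM2l h0); nra.
  rewrite leNgt; apply/negP => lt.
  have KB : 0 <= K * B by rewrite mulr_ge0.
  pose d := wsum mu b - S.
  have dgt0 : 0 < d by rewrite /d subr_gt0.
  (* This h satisfies h <= 1 and K B h < d, against d <= K B h. *)
  pose h := d / (d + K * B + 1).
  have den : 0 < d + K * B + 1 by lra.
  have h0 : 0 < h by rewrite divr_gt0.
  have hE : h * (d + K * B + 1) = d by rewrite /h mulfVK // lt0r_neq0.
  have h1 : h <= 1 by rewrite /h ler_pdivrMr // mul1r; lra.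
  have := main h h0 h1; rewrite /d in hE dgt0 *; nra.
(* The frame [w] of the product also diagonalizes e^{ib}, which therefore commutes with the product
   and, after cancelling e^{ib}, with the other factor. *)
have bw : cisdiag g b = cisdiag w b.
  have Eh : hdiag g b = hdiag w b by apply: eqH; apply/le_anti/andP.
  apply: (udiag_change gu wu Eh) => j k.
  by rewrite !mxE => /complexI ->.
have gun := cisdiag_unitary b gu.
have cb : comm_mx (cisdiag g b) (cisdiag w q).
  by rewrite bw /comm_mx /cisdiag !udiagM //; congr udiag; apply/rowP => k; rewrite !mxE mulrC.
move: cb; rewrite /comm_mx E -!mulmxA => /(congr1 (mulmx (cisdiag g (- b)))).
by rewrite !(mulmxA (cisdiag g (- b))) -cisdiagD // addNr cisdiag0 // !mul1mx.
Qed.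

(* With b = e^{i p0} and X = e^{i h}: b (X b X) = X^* (X b)^2 X and X b X = X^* (X X b) X. *)
Lemma wsum_phase_midpoint (A : R) g (h : 'rV[R]_n) v0 v1 v2 (p0 p1 p2 : 'rV[R]_n) :
  0 <= A -> A < pi / 2 ->
  g \is unitarymx -> v0 \is unitarymx -> v1 \is unitarymx -> v2 \is unitarymx ->
  noninc_row p0 -> noninc_row p1 -> noninc_row p2 ->
  (forall k, `|p0 0 k| <= A) -> (forall k, `|p1 0 k| <= A) -> (forall k, `|p2 0 k| <= A) ->
  cisdiag v1 p1 = cisdiag g h *m cisdiag v0 p0 ->
  cisdiag v2 p2 = cisdiag g h *m cisdiag v1 p1 ->
  2 * wsum mu p1 <= wsum mu p0 + wsum mu p2 /\
  (2 * wsum mu p1 = wsum mu p0 + wsum mu p2 -> comm_mx (cisdiag g h) (cisdiag v0 p0)).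
Proof.
move=> A0 A2 gu u0 u1 u2 d0 d1 d2 a0 a1 a2 E1 E2.
set X := cisdiag g h in E1 E2 *; set b := cisdiag v0 p0 in E1 *.
have Xu : X \is unitarymx by exact: cisdiag_unitary.
have Xa : X^t* *m X = 1%:M := adj_mulmx Xu.
have au := unitary_adj Xu.
have conjX (v : 'M[C]_n) (r : 'rV[R]_n) : cisdiag (X^t* *m v) r = X^t* *m cisdiag v r *m X.
  by rewrite /cisdiag -udiag_conj trmxCK.
have XM (N N' : 'M[C]_n) : X^t* *m (X *m N) *m N' = N *m N'.
  by rewrite mulmxA Xa mul1mx.
have c2 : cisdiag (X^t* *m v2) p2 = X *m b *m X by rewrite conjX E2 E1 XM.
have c1 := conjX v1.
have w1 : X^t* *m v1 \is unitarymx := mul_unitarymx au u1.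
have w2 : X^t* *m v2 \is unitarymx := mul_unitarymx au u2.
have dd1 : noninc_row (2 *: p1) by move=> j k jk; rewrite !mxE ler_wpM2l // d1.
have aa1 k : `|(2 *: p1) 0 k| <= 2 * A by rewrite mxE normrM ger0_norm // ler_wpM2l.
have sq (r : 'rV[R]_n) (v : 'M[C]_n) : v \is unitarymx -> cisdiag v (2 *: r) = cisdiag v r *m cisdiag v r.
  by move=> vu; rewrite -cisdiagD // scaler_nat mulr2n.
have EW : cisdiag (X^t* *m v1) (2 *: p1) = b *m cisdiag (X^t* *m v2) p2.
  by rewrite c1 sq // E1 c2 -(mulmxA X b) XM !mulmxA.
have [le eq] := wsum_phase_subadditive A0 A2 w1 w2 u0 d2 d0 dd1 a2 a0 aa1 EW.
split; first by rewrite -wsumZ.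
move=> H; have {eq}comm : comm_mx b (X *m b *m X).
  by rewrite -c2; apply: eq; rewrite wsumZ.
have E : cisdiag (X^t* *m v1) (2 *: p1) = cisdiag v1 (2 *: p1).
  by rewrite EW c2 comm sq // E1 !mulmxA.
(* Conjugation by X fixes (X b)^2. Its phases, those of X b doubled, still differ by less than 2 pi,
   so conjugation by X fixes the square root X b too, which reads b X = X b. *)
have : cisdiag (X^t* *m v1) p1 = cisdiag v1 p1.
  apply: (udiag_change w1 u1 E) => j k; rewrite !mxE => /cis_inj H'.
  have -> : p1 0 j = p1 0 k; last by [].
  apply: (@mulfI _ (2 : R)) => //; apply: H'; rewrite -mulrBr normrM ger0_norm //.
  have := ler_normB (p1 0 j) (p1 0 k); have := a1 j; have := a1 k; lra.
by rewrite c1 E1 XM /comm_mx => ->.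
Qed.

End PhaseSums.

(** * Entrywise limits and the power series of e^{ia} *)

Section ComplexLimits.
Context {R : realType}.
Local Notation C := (R[i] : numFieldType).

Lemma cvg_complex (u v : nat -> R) (a b : R) : u @ \oo --> a -> v @ \oo --> b ->
  (fun k => u k +i* v k : C) @ \oo --> (a +i* b : C).
Proof.
move=> ua vb; apply/cvgrPdist_lt => -[e1 e2]; rewrite ltcE/= => /andP[/eqP -> e0].
have e20 : 0 < e1 / 2 by rewrite divr_gt0.
near=> k.
have h1 : `|a - u k| < e1 / 2 by near: k; move/cvgrPdist_lt: ua; exact.
have h2 : `|b - v k| < e1 / 2 by near: k; move/cvgrPdist_lt: vb; exact.
rewrite normc_def/= -/(e1%:C) ltcR.
have : Num.sqrt ((a - u k) ^+ 2 + (b - v k) ^+ 2) <= `|a - u k| + `|b - v k|.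
  rewrite -[leRHS]ger0_norm ?addr_ge0 // -sqrtr_sqr ler_sqrt ?sqr_ge0 //.
  have := real_normK (num_real (a - u k)); have := real_normK (num_real (b - v k)).
  have := mulr_ge0 (normr_ge0 (a - u k)) (normr_ge0 (b - v k)); lra.
lra.
Unshelve. all: by end_near. Qed.

Lemma cvg_mx (K : numFieldType) m n (F : nat -> 'M[K]_(m, n)) (L : 'M[K]_(m, n)) :
  (forall i j, (fun k => F k i j) @ \oo --> L i j) -> F @ \oo --> L.
Proof.
move=> FL; apply/cvg_ballP => e e0.
have H : \forall k \near \oo, forall i j, ball (L i j) e (F k i j).
  apply: filter_forall => i; apply: filter_forall => j.
  by move/cvg_ballP : (FL i j); apply.
by near=> k; split=> // i j; move: i j; near: k.
Unshelve. all: by end_near. Qed.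

Lemma lim_mx (K : numFieldType) m n (F : nat -> 'M[K]_(m, n)) (L : 'M[K]_(m, n)) :
  (forall i j, (fun k => F k i j) @ \oo --> L i j) -> limn F = L.
Proof. by move=> FL; apply: cvg_lim; [exact: norm_hausdorff|exact: cvg_mx]. Qed.

Lemma cvg_linear_combination (K : numFieldType) (I : finType) (a b l : I -> K) (f : I -> nat -> K) :
  (forall i, f i @ \oo --> l i) ->
  (fun k => \sum_i a i * f i k * b i) @ \oo --> \sum_i a i * l i * b i.
Proof.
move=> fl; elim: (index_enum I) => [|i s IH].
  rewrite big_nil; under eq_fun do rewrite big_nil; exact: cvg_cst.
rewrite big_cons; under eq_fun do rewrite big_cons.
apply: cvgD => //; apply: cvgM; last exact: cvg_cst.
by apply: cvgM => //; exact: cvg_cst.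
Qed.

Lemma imaginary_exp_coeff (a : R) (m : nat) :
  (m`!%:R)^-1 * ('i * a%:C) ^+ m = cos_coeff a m +i* sin_coeff a m :> R[i].
Proof.
have iE : 'i ^+ m = ((~~ odd m)%:R * (-1) ^+ m./2) +i* ((odd m)%:R * (-1) ^+ m.-1./2) :> R[i].
  have iD k : 'i ^+ k.*2 = ((-1) ^+ k)%:C :> R[i].
    by rewrite -muln2 mulnC exprM sqr_i rmorphXn rmorphN1.
  rewrite -{1}(odd_double_half m); case: (odd m) (odd_double_half m) => /= mE.
    have -> : m.-1./2 = m./2 by rewrite -{1}mE add1n/= doubleK.
    rewrite add1n exprS iD.
    by apply/eqP; rewrite eq_complex/=; apply/andP; split; apply/eqP; ring.
  rewrite add0n iD.
  by apply/eqP; rewrite eq_complex/=; apply/andP; split; apply/eqP; ring.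
have fE : (m`!%:R : R[i])^-1 = ((m`!%:R)^-1 : R)%:C by rewrite fmorphV rmorph_nat.
rewrite fE exprMn iE -rmorphXn /cos_coeff /sin_coeff/=.
by apply/eqP; rewrite eq_complex/=; apply/andP; split; apply/eqP; rewrite -?exprnP; ring.
Qed.

Lemma cvg_series_cis (a : R) :
  series (fun m => (m`!%:R)^-1 * ('i * a%:C) ^+ m : C) @ \oo --> (cis a : C).
Proof.
have -> : series (fun m => (m`!%:R)^-1 * ('i * a%:C) ^+ m) =
    (fun k => series (cos_coeff a) k +i* series (sin_coeff a) k) :> (nat -> R[i]).
  apply/funext => k; rewrite /series/=; elim: k => [|k IH]; first by rewrite !big_nil.
  by rewrite !big_nat_recr//= IH imaginary_exp_coeff.
apply: cvg_complex.
  by rewrite cos.unlock; exact: is_cvg_series_cos_coeff.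
by rewrite sin.unlock; exact: is_cvg_series_sin_coeff.
Qed.

End ComplexLimits.

(** * Exponential and spectral norm of diagonalized matrices *)

Section OperatorNorm.
Local Open Scope sesquilinear_scope.
Context {R : realType} {n : nat}.
Local Notation C := R[i].
Implicit Types (v : 'M[C]_n) (d e : 'rV[C]_n) (p : 'rV[R]_n) (x : 'cV[C]_n).

Lemma expmx_udiag v d e : v \is unitarymx ->
  (forall k, series (fun m => (m`!%:R)^-1 * d 0 k ^+ m : (C : numFieldType)) @ \oo
     --> (e 0 k : (C : numFieldType))) ->
  expmx (udiag v d) = udiag v e.
Proof.
move=> vu de; rewrite /expmx.
have pow m : udiag v d ^+ m = udiag v (\row_k d 0 k ^+ m).
  elim: m => [|m IH].
    by rewrite expr0 -[1]/(1%:M) -(udiag1 vu); congr udiag; apply/rowP => k; rewrite !mxE expr0.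
  by rewrite exprS IH -mulmxE udiagM //; congr udiag; apply/rowP => k; rewrite !mxE exprS.
have -> : series (fun m => (m`!%:R)^-1 *: udiag v d ^+ m) =
    fun N => udiag v (\row_k series (fun m => (m`!%:R)^-1 * d 0 k ^+ m) N).
  apply/funext => N; rewrite /series/=; elim: N => [|N IH].
    rewrite big_nil; apply/matrixP => i j; rewrite udiagE mxE big1 // => k _.
    by rewrite mxE big_nil mulr0 mul0r.
  rewrite big_nat_recr//= IH pow udiagZ udiagD; congr udiag; apply/rowP => k.
  by rewrite !mxE big_nat_recr.
apply: (@lim_mx (R[i] : numFieldType)) => i j; rewrite udiagE.
under eq_fun do rewrite udiagE.
apply: (@cvg_linear_combination (R[i] : numFieldType)) => k.
by under eq_fun do rewrite mxE; exact: de.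
Qed.

Lemma expmx_hdiag v p (t : R) : v \is unitarymx ->
  expmx (('i * t%:C) *: hdiag v p) = cisdiag v (t *: p).
Proof.
move=> vu; rewrite /hdiag udiagZ; apply: expmx_udiag => // k; rewrite !mxE.
by rewrite -mulrA -rmorphM; exact: cvg_series_cis.
Qed.

Lemma expmx_ihdiag v p : v \is unitarymx -> expmx ('i *: hdiag v p) = cisdiag v p.
Proof.
have E : 'i * 1%:C = 'i :> C.
  by apply/eqP; rewrite eq_complex/=; apply/andP; split; apply/eqP; ring.
by move=> vu; have := expmx_hdiag p 1 vu; rewrite (scale1r p) E.
Qed.

Definition l2sq x : R := \sum_(i < n) Normc.normc (x i 0) ^+ 2.

Lemma l2sq_ge0 x : 0 <= l2sq x.
Proof. by apply: sumr_ge0 => i _; exact: sqr_ge0. Qed.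

Lemma l2sqE x : (l2sq x)%:C = (x^t* *m x) 0 0.
Proof.
rewrite /l2sq rmorph_sum/= mxE; apply: eq_bigr => i _.
by rewrite normcJE !mxE mulrC.
Qed.

Lemma l2sq_unitary v x : v \is unitarymx -> l2sq (v *m x) = l2sq x.
Proof.
move=> vu; apply: complexI; rewrite !l2sqE trmx_mul map_mxM mulmxA.
by rewrite -(mulmxA _ (v^t*)) adj_mulmx // mulmx1.
Qed.

Lemma l2norm_udiag_le v d x (c : R) : v \is unitarymx -> 0 <= c ->
  (forall k, Normc.normc (d 0 k) <= c) -> l2norm (udiag v d *m x) <= c * l2norm x.
Proof.
move=> vu c0 dc; rewrite /l2norm -!/(l2sq _).
rewrite udiag_def -!mulmxA l2sq_unitary // -(l2sq_unitary x (unitary_adj vu)).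
rewrite -[c]ger0_norm // -sqrtr_sqr -sqrtrM ?sqr_ge0 // ler_sqrt ?mulr_ge0 ?sqr_ge0 ?l2sq_ge0 //.
rewrite /l2sq mulr_sumr; apply: ler_sum => i _.
have n0 (z : C) : 0 <= Normc.normc z by case: z => ? ?; exact: sqrtr_ge0.
rewrite mul_diag_mx mxE Normc.normcM exprMn ler_wpM2r ?sqr_ge0 //.
by rewrite ler_pXn2r ?nnegrE.
Qed.

Lemma opnorm_udiag_le v d (c : R) : v \is unitarymx -> 0 <= c ->
  (forall k, Normc.normc (d 0 k) <= c) -> opnorm (udiag v d) <= c.
Proof.
move=> vu c0 dc; apply: sup_le_ub.
  exists (l2norm (udiag v d *m 0)), 0 => //=.
  by rewrite /l2norm big1 ?sqrtr0 // => i _; rewrite mxE Normc.normc0 expr0n.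
move=> _ [x /= x1 <-]; apply: le_trans (l2norm_udiag_le x vu c0 dc) _.
by rewrite ler_piMr.
Qed.

(** The test vector is column k of [v], a unit eigenvector. The crude bound [c] shows that the
    supremum is taken over a bounded set. *)
Lemma opnorm_udiag_ge v d k : v \is unitarymx -> Normc.normc (d 0 k) <= opnorm (udiag v d).
Proof.
move=> vu.
have n0 (z : C) : 0 <= Normc.normc z by case: z => ? ?; exact: sqrtr_ge0.
pose c := \sum_j Normc.normc (d 0 j).
have c0 : 0 <= c by apply: sumr_ge0.
have dc j : Normc.normc (d 0 j) <= c by rewrite /c (bigD1 j)//= lerDl sumr_ge0.
have e1 : l2norm (v *m (delta_mx k 0 : 'cV[C]_n)) = 1.
  rewrite /l2norm -/(l2sq _) l2sq_unitary // /l2sq (bigD1 k)//= big1 => [|j jk].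
    by rewrite addr0 mxE !eqxx Normc.normc1 expr1n sqrtr1.
  by rewrite mxE (negPf jk) Normc.normc0 expr0n.
apply: ub_le_sup.
  exists c => _ [x /= x1 <-]; apply: le_trans (l2norm_udiag_le x vu c0 dc) _.
  by rewrite ler_piMr.
exists (v *m (delta_mx k 0 : 'cV[C]_n)) => /=; first by rewrite e1.
have -> : udiag v d *m (v *m (delta_mx k 0 : 'cV[C]_n)) = v *m (d 0 k *: (delta_mx k 0 : 'cV[C]_n)).
  rewrite udiag_def !mulmxA -(mulmxA _ (v^t*)) adj_mulmx // mulmx1 -mulmxA; congr (_ *m _).
  apply/matrixP => i j; rewrite mul_diag_mx !mxE.
  by case: (i =P k) => [->|_] //=; rewrite !mulr0.
rewrite /l2norm -/(l2sq _) l2sq_unitary // /l2sq (bigD1 k)//= big1 => [|j jk].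
  by rewrite addr0 !mxE !eqxx mulr1 sqrtr_sqr ger0_norm.
by rewrite !mxE (negPf jk) mulr0 Normc.normc0 expr0n.
Qed.

End OperatorNorm.

(** * The principal logarithm and the functional [f_mu] *)

Section LogarithmAndTrace.
Local Open Scope sesquilinear_scope.
Context {R : realType} {n : nat}.
Local Notation C := R[i].
Implicit Types (u v w : 'M[C]_n) (p q : 'rV[R]_n).

(** Turns finitely many strict bounds into a uniform one with a margin; starting the maximum at 0
    covers the empty row. *)
Lemma row_bound p (c : R) : 0 < c -> (forall k, `|p 0 k| < c) ->
  exists2 A, 0 <= A < c & forall k, `|p 0 k| <= A.
Proof.
move=> c0 pc; exists (\big[Num.max/0]_k `|p 0 k|).
  by apply/andP; split; [exact: bigmax_ge_id|apply/bigmax_ltP].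
by move=> k; exact: le_bigmax.
Qed.

Lemma opnorm_hdiag_ge v p k : v \is unitarymx -> `|p 0 k| <= opnorm (hdiag v p).
Proof.
move=> vu; have := opnorm_udiag_ge (map_mx (real_complex R) p) k vu.
by rewrite mxE /= expr0n addr0 sqrtr_sqr.
Qed.

Lemma opnorm_hdiag_lt v p (c : R) : v \is unitarymx -> 0 < c ->
  (forall k, `|p 0 k| < c) -> opnorm (hdiag v p) < c.
Proof.
move=> vu c0 /(row_bound c0)[A /andP[A0 Ac] pA].
apply: le_lt_trans Ac; apply: opnorm_udiag_le => // k.
by rewrite mxE /= expr0n addr0 sqrtr_sqr.
Qed.

Lemma cos_gt0_of_opnorm v p k : v \is unitarymx ->
  opnorm (cisdiag v p - 1) < Num.sqrt 2 -> 0 < cos (p 0 k).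
Proof.
move=> vu.
have -> : cisdiag v p - 1 = udiag v (map_mx cis p - const_mx 1).
  by rewrite -udiagD -[- const_mx 1]scaleN1r -udiagZ udiag1 // scaleN1r.
move=> lt2; have := le_lt_trans (opnorm_udiag_ge _ k vu) lt2.
rewrite !mxE /= ltr_sqrt // oppr0 addr0.
have := cos2Dsin2 (p 0 k); nra.
Qed.

(** The set behind [logmx] must be inhabited, or its default 0 is returned. The witness takes phases
    in [-pi, pi]; the ends are excluded because the cosine of each phase is positive. *)
Lemma logmxP u : u \is unitarymx -> opnorm (u - 1) < Num.sqrt 2 ->
  let z := (- 'i) *: logmx u in
  [/\ z \is hermsymmx, expmx ('i *: z) = u & opnorm z < pi].
Proof.
move=> uu u1 z.
have [v [p [vu E pp]]] := unitary_cisdiag uu.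
have p0 := @pi_gt0 R.
have -> : z = xget 0 [set z : 'M[C]_n | [/\ z \is hermsymmx, expmx ('i *: z) = u & opnorm z < pi]].
  rewrite /z /logmx scalerA.
  have -> : - 'i * 'i = 1 :> C by rewrite mulNr -expr2 sqr_i opprK.
  by rewrite scale1r.
have ex : [set z : 'M[C]_n | [/\ z \is hermsymmx, expmx ('i *: z) = u & opnorm z < pi]] (hdiag v p).
  split; [exact: hdiag_hermitian|by rewrite expmx_ihdiag|].
  apply: opnorm_hdiag_lt => // k; rewrite lt_neqAle pp andbT; apply/eqP => e.
  move: (u1); rewrite E => /(cos_gt0_of_opnorm k vu).
  by rewrite -cos_norm e cospi; lra.
exact: (xgetPex 0 (ex_intro _ _ ex)).
Qed.

Variable mu : 'rV[R]_n.

Lemma trace_hdiag2 w v p :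
  \tr (hdiag w mu *m hdiag v p) = (\sum_j \sum_k mu 0 j * p 0 k * overlap w v j k)%:C.
Proof.
rewrite trace_udiag2 rmorph_sum/=; apply: eq_bigr => j _.
by rewrite rmorph_sum/=; apply: eq_bigr => k _; rewrite !mxE !rmorphM.
Qed.

Lemma f_mu_setE w : w \is unitarymx ->
  w *m diag_mx (map_mx (real_complex R) mu) *m invmx w = hdiag w mu.
Proof. by move=> wu; rewrite invmx_unitary // /hdiag udiag_def. Qed.

(** The frame [v] is itself a competitor, with [p] in any order, so each permutation of the
    eigenvalues yields a lower bound for [f_mu]. *)
Lemma f_mu_ge v p : v \is unitarymx -> wsum mu p <= f_mu mu (hdiag v p).
Proof.
move=> vu; apply: ub_le_sup.
  exists (\sum_j \sum_k `|mu 0 j| * `|p 0 k|) => r [w wu].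
  rewrite f_mu_setE // trace_hdiag2 => /complexI ->.
  apply: ler_sum => j _; apply: ler_sum => k _; rewrite -normrM.
  apply: le_trans (ler_norm _) _; rewrite (normrM (mu 0 j * p 0 k)) (ger0_norm (overlap_ge0 w v j k)).
  by rewrite ler_piMr // overlap_le1.
exists v => //; rewrite f_mu_setE // /hdiag udiagM // -[udiag v _]mulmx1 trace_udiag.
rewrite rmorph_sum/=; apply: eq_bigr => k _.
by rewrite mulmx1 adj_mulmx // !mxE eqxx mulr1 rmorphM.
Qed.

Hypothesis mudec : forall j k : 'I_n, (j < k)%N -> mu 0 k < mu 0 j.

Lemma f_mu_hdiag v p : v \is unitarymx -> noninc_row p -> f_mu mu (hdiag v p) = wsum mu p.
Proof.
move=> vu pdec; apply/le_anti/andP; split; last exact: f_mu_ge.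
apply: sup_le_ub.
  exists (\sum_j \sum_k mu 0 j * p 0 k * overlap v v j k), v => //.
  by rewrite f_mu_setE // trace_hdiag2.
move=> r [w wu]; rewrite f_mu_setE // trace_hdiag2 => /complexI ->.
by have [] := overlap_rearrangement wu vu mudec pdec.
Qed.

(** Commutation makes x + i z normal; the real and imaginary parts of its eigenvalues then
    diagonalize x and z in one frame. *)
Lemma comm_hermitian_codiag (x z : 'M[C]_n) : x \is hermsymmx -> z \is hermsymmx ->
  comm_mx x z -> exists w a b, [/\ w \is unitarymx, x = hdiag w a & z = hdiag w b].
Proof.
move=> /hermsymmxP xh /hermsymmxP zh xz.
pose N := x + 'i *: z.
have Na : N^t* = x - 'i *: z.
  rewrite /N linearD linearZ/= map_mxD map_mxZ xh zh -scaleNr.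
  by congr (_ + _ *: _); apply/eqP; rewrite eq_complex/= oppr0 !eqxx.
have Nn : N \is normalmx.
  apply/normalmxP; rewrite Na /N !mulmxDl !mulmxDr !mulmxN !mulNmx -!scalemxAl -!scalemxAr xz.
  by rewrite !addrA; congr (_ - _); rewrite addrAC.
have [w [d [wu E]]] := normal_udiag Nn.
pose a := \row_k complex.Re (d 0 k); pose b := \row_k complex.Im (d 0 k).
have E1 : N = hdiag w a + 'i *: hdiag w b.
  rewrite E /hdiag udiagZ udiagD; congr udiag; apply/rowP => k; rewrite !mxE.
  by case: (d 0 k) => r s; apply/eqP; rewrite eq_complex/=; apply/andP; split; apply/eqP; ring.
have E2 : N^t* = hdiag w a - 'i *: hdiag w b.
  rewrite E udiag_adj /hdiag -scaleNr udiagZ udiagD; congr udiag; apply/rowP => k; rewrite !mxE.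
  by case: (d 0 k) => r s; apply/eqP; rewrite eq_complex/=; apply/andP; split; apply/eqP; ring.
have xE : x = hdiag w a.
  have : x + x = hdiag w a + hdiag w a.
    have -> : x + x = N + N^t* by rewrite Na /N addrACA subrr addr0.
    by rewrite {1}E1 E2 addrACA subrr addr0.
  move=> /matrixP H; apply/matrixP => i j; have := H i j; rewrite [LHS]mxE [RHS]mxE.
  by case: (x i j) (hdiag w a i j) => [r s] [r' s'] [e1 e2]; congr (_ +i* _); lra.
exists w, a, b; split=> //.
have : 'i *: z = 'i *: hdiag w b by apply: (addrI x); rewrite {2}xE -E1.
move=> /(congr1 (fun M => (- 'i) *: M)); rewrite !scalerA.
have -> : - 'i * 'i = 1 :> C by rewrite mulNr -expr2 sqr_i opprK.
by rewrite !scale1r.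
Qed.

End LogarithmAndTrace.

(** * Affine phases that cannot leave the right half plane *)

Section AffinePhase.
Context {R : realType}.

(** A phase leaving the interval would pass through pi/2 or -pi/2, where the cosine vanishes; for an
    affine phase the passage time is explicit. *)
Lemma affine_phase_lt (a b T : R) : `|b| < pi / 2 ->
  (forall t, t \in `[0, T] -> 0 < cos (t * a + b)) ->
  forall t, t \in `[0, T] -> `|t * a + b| < pi / 2.
Proof.
have up (c d t : R) : `|d| < pi / 2 -> (forall s, 0 <= s <= t -> 0 < cos (s * c + d)) ->
    0 <= t -> t * c + d < pi / 2.
  rewrite ltr_norml => /andP[_ d1] pos t0; rewrite ltNge; apply/negP => h.
  have c0 : 0 < c by nra.
  have sE : (pi / 2 - d) / c * c = pi / 2 - d by rewrite mulfVK // lt0r_neq0.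
  have := pos ((pi / 2 - d) / c); rewrite sE subrK cos_pihalf ltxx => H.
  apply: notF; apply: H; move: ((pi / 2 - d) / c) sE => s sE.
  by apply/andP; split; nra.
move=> b1 pos t /[!in_itv]/= /andP[t0 tT].
have pos' s : 0 <= s <= t -> 0 < cos (s * a + b).
  by move=> /andP[s0 st]; apply: pos; rewrite in_itv/= s0 (le_trans st).
have h1 := up a b t b1 pos' t0.
have h2 : t * - a + - b < pi / 2.
  apply: up => //; first by rewrite normrN.
  by move=> s st; rewrite mulrN -opprD cosN; exact: pos'.
by rewrite ltr_norml h1 andbT; lra.
Qed.

End AffinePhase.

(** * Convexity and piecewise linearity along the curve *)

Unset Implicit Arguments.
Set Strict Implicit.

(** The curve sees y only through e^{iy}. If y has eigenvalues 0 and 2 pi, then e^{iy} = 1 and the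
    function is piecewise linear, although x and y may fail to commute. Hence the equivalence is
    stated for [opnorm y < pi], where y is the principal logarithm z(0). *)
Theorem theorem5p13 (R : realType) (n : nat) (x y : 'M[R[i]]_n) (t0 : R)
    (z : R -> 'M[R[i]]_n) (theta : R -> 'rV[R]_n) (mu : 'rV[R]_n)
    (hx : x \is hermsymmx) (hy : y \is hermsymmx) (ht0 : 0 < t0)
    (hu : forall t : R, t \in `[0, t0] ->
       opnorm (curve x y t - 1) < Num.sqrt 2)
    (hz : forall t : R, t \in `[0, t0] ->
       z t = (- 'i) *: logmx (curve x y t))
    (htheta : forall t : R, t \in `[0, t0] ->
       sorted_eigenvalues (z t) (theta t))
    (hmu : forall j k : 'I_n, (j < k)%N -> mu 0 k < mu 0 j) :
  [/\ forall t : R, t \in `[0, t0] ->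
        [/\ expmx ('i *: z t) = curve x y t,
            char_poly (curve x y t) =
              \prod_(k < n)
                 ('X - (cos (theta t 0 k) +i* sin (theta t 0 k))%:P) &
            f_mu mu (z t) = \sum_(k < n) mu 0 k * theta t 0 k],
      opnorm y < pi ->
        (strictly_convex_on 0 t0 (fun t => f_mu mu (z t)) <->
         ~ comm_mx x y) &
      comm_mx x y -> piecewise_linear_on 0 t0 (fun t => f_mu mu (z t))].
Proof.
have p0 := @pi_gt0 R.
have [g [xi [gu xE]]] := hermitian_hdiag hx.
have [gy [eta [gyu yE]]] := hermitian_hdiag hy.
have curveE t : curve x y t = cisdiag g (t *: xi) *m cisdiag gy eta.
  by rewrite /curve xE yE expmx_hdiag // expmx_ihdiag.
have curve_step s t : curve x y t = cisdiag g ((t - s) *: xi) *m curve x y s.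
  by rewrite !curveE mulmxA -cisdiagD // -scalerDl subrK.
have curveu t : curve x y t \is unitarymx.
  by rewrite curveE; apply: mul_unitarymx; exact: cisdiag_unitary.
have logP t : t \in `[0, t0] ->
    [/\ z t \is hermsymmx, expmx ('i *: z t) = curve x y t & opnorm (z t) < pi].
  by move=> tI; rewrite (hz _ tI); exact: logmxP (curveu t) (hu _ tI).
have /choice[V HV] t : exists v : 'M[R[i]]_n, t \in `[0, t0] ->
    [/\ v \is unitarymx, z t = hdiag v (theta t), curve x y t = cisdiag v (theta t),
        (forall k, `|theta t 0 k| < pi / 2) & noninc_row (theta t)].
  have [tI|_] := boolP (t \in `[0, t0]); last by exists 0.
  have [zh zexp zpi] := logP t tI; have [chi dec] := htheta t tI.
  have [v vu zE] := hermitian_hdiag_of_char_poly zh chi.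
  have cE : curve x y t = cisdiag v (theta t) by rewrite -zexp zE expmx_ihdiag.
  exists v => _; split=> // k; apply: cos_gt0_abs.
    by apply: le_lt_trans zpi; rewrite zE; exact: opnorm_hdiag_ge.
  by apply: (@cos_gt0_of_opnorm _ _ v) => //; rewrite -cE; exact: hu.
have fE t : t \in `[0, t0] -> f_mu mu (z t) = wsum mu (theta t).
  by move=> tI; have [vu -> _ _ dec] := HV t tI; exact: f_mu_hdiag.
have PL : comm_mx x y -> piecewise_linear_on 0 t0 (fun t => f_mu mu (z t)).
  move=> xy.
  have o0 : 0 \in `[0, t0] by rewrite in_itv/= lexx ltW.
  have [v0u z0E c0E th0 _] := HV 0 o0; have [z0h z0exp z0pi] := logP 0 o0.
  (* Here y may lie off the principal branch, so the common eigenbasis is sought for x and z(0): x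
     commutes with e^{iy} = u(0), and z(0) is a function of u(0). *)
  have xc0 : comm_mx x (curve x y 0).
    rewrite curveE scale0r cisdiag0 // mul1mx.
    move: xy; rewrite yE => xy; apply: (udiag_comm gyu xy) => j k.
    by rewrite !mxE => /complexI ->.
  have xz0 : comm_mx x (z 0).
    rewrite z0E; move: xc0; rewrite c0E => xc0; apply: (udiag_comm v0u xc0) => j k.
    rewrite !mxE => /cis_inj ->//; apply: le_lt_trans (ler_normB _ _) _.
    by have := th0 j; have := th0 k; lra.
  have [w [a [b [wu xa zb]]]] := comm_hermitian_codiag hx z0h xz0.
  have cE t : curve x y t = cisdiag w (t *: a + b).
    have Y0 : expmx ('i *: y) = cisdiag w b.
      by rewrite -(expmx_ihdiag b wu) -zb z0exp curveE scale0r cisdiag0 // mul1mx yE expmx_ihdiag.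
    have X0 : expmx (('i * t%:C) *: x) = cisdiag w (t *: a).
      by rewrite xa; exact: expmx_hdiag.
    rewrite /curve X0 Y0.
    by rewrite (cisdiagD _ _ wu).
  have cos0' t k : t \in `[0, t0] -> 0 < cos (t * a 0 k + b 0 k).
    move=> tI; have := hu t tI; rewrite cE => /(cos_gt0_of_opnorm k wu).
    by rewrite !mxE.
  have b0 k : `|b 0 k| < pi / 2.
    apply: cos_gt0_abs.
      by apply: le_lt_trans z0pi; rewrite zb; exact: opnorm_hdiag_ge.
    by have := cos0' 0 k o0; rewrite mul0r add0r.
  have ph t k : t \in `[0, t0] -> `|(t *: a + b) 0 k| < pi / 2.
    by move=> tI; rewrite !mxE; apply: (affine_phase_lt (b0 k) (cos0'^~ k)) tI.
  have zE t : t \in `[0, t0] -> z t = hdiag w (t *: a + b).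
    move=> tI; have [vu -> cv th _] := HV t tI.
    have E : cisdiag (V t) (theta t) = cisdiag w (t *: a + b) by rewrite -cv cE.
    apply: (udiag_change vu wu E) => j k; rewrite [LHS]mxE [RHS]mxE => /cis_inj H.
    rewrite [LHS]mxE [RHS]mxE H //; apply: le_lt_trans (ler_normB _ _) _.
    by have := th k; have := ph t j tI; lra.
  (* Each permutation gives one affine function of t, a lower bound everywhere; the one that sorts
     the phases at t is attained at t. *)
  pose perm_row (s : 'S_n) t : 'rV[R]_n := \row_k (t *: a + b) 0 (s k).
  have permE (s : 'S_n) t : exists2 w', w' \is unitarymx & hdiag w (t *: a + b) = hdiag w' (perm_row s t).
    have [w' w'u Ew] := udiag_perm s wu; exists w' => //.
    by rewrite /hdiag Ew; congr udiag; apply/rowP => k; rewrite !mxE.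
  have lin (s : 'S_n) t : (\sum_k mu 0 k * a 0 (s k)) * t + \sum_k mu 0 k * b 0 (s k)
      = wsum mu (perm_row s t).
    rewrite mulr_suml -big_split/=; apply: eq_bigr => k _; rewrite !mxE; ring.
  apply: (@piecewise_linear_max _ _ (fun s : 'S_n => \sum_k mu 0 k * a 0 (s k))
    (fun s : 'S_n => \sum_k mu 0 k * b 0 (s k))) => // [t s tI|t tI].
    by rewrite lin zE //; have [w' w'u ->] := permE s t; exact: f_mu_ge.
  have [s sdec] := row_sort (t *: a + b); exists s.
  rewrite lin zE //; have [w' w'u ->] := permE s t; apply: f_mu_hdiag => //.
  by move=> j k jk; rewrite ![perm_row _ _ _ _]mxE; exact: sdec.
split=> //.
- move=> t tI; have [vu zE cE th dec] := HV t tI; split.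
  + by rewrite zE expmx_ihdiag.
  + by rewrite cE char_poly_udiag //; apply: eq_bigr => k _; rewrite mxE.
  + exact: fE.
- move=> ypi; split=> [cvx xy|nxy].
    exact: piecewise_linear_not_strictly_convex (PL xy) cvx.
  have lip : exists L, forall s t, s \in `[0, t0] -> t \in `[0, t0] ->
      `|f_mu mu (z s) - f_mu mu (z t)| <= L * `|s - t|.
    have D2 : (pi : R) < pi *+ 2 by lra.
    have [K K0 HK] := wsum_step hmu D2.
    pose S := \sum_j \sum_k `|mu 0 j| * `|xi 0 k|.
    pose B := \sum_k xi 0 k ^+ 2.
    have B0 : 0 <= B by apply: sumr_ge0 => k _; exact: sqr_ge0.
    (* [S] bounds the first-order term, and |t - s| <= t0 makes the quadratic error linear. The step
       estimate allows either sign of t - s, so exchanging s and t gives both halves. *)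
    exists (S + K * t0 * B).
    have half s t : s \in `[0, t0] -> t \in `[0, t0] ->
        wsum mu (theta t) - wsum mu (theta s) <= (S + K * t0 * B) * `|s - t|.
      move=> sI tI.
      have [vs _ cs ths ds] := HV s sI; have [vt _ ct tht dt] := HV t tI.
      have dist j k : `|theta s 0 k - theta t 0 j| <= pi.
        by apply: le_trans (ler_normB _ _) _; have := ths k; have := tht j; lra.
      have := HK _ _ g _ _ xi (t - s) vt vs gu ds dist.
      rewrite -cs -ct -curve_step => /(_ erefl); rewrite -/B.
      set Q := \sum_j _ => H.
      have QS : `|Q| <= S.
        apply: le_trans (ler_norm_sum _ _ _) _; apply: ler_sum => j _.
        apply: le_trans (ler_norm_sum _ _ _) _; apply: ler_sum => k _.
        rewrite (normrM (mu 0 j * xi 0 k)) (ger0_norm (overlap_ge0 _ _ _ _)) normrM.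
        by rewrite ler_piMr ?mulr_ge0 // overlap_le1.
      have h1 : (t - s) * Q <= S * `|s - t|.
        apply: le_trans (ler_norm _) _; rewrite normrM distrC mulrC.
        by rewrite ler_wpM2r.
      have h2 : (t - s) ^+ 2 <= t0 * `|s - t|.
        rewrite -real_normK ?num_real // expr2 distrC ler_wpM2r //.
        move: sI tI; rewrite !in_itv/= => /andP[s0 s1] /andP[tp t1].
        by rewrite ler_norml; apply/andP; split; lra.
      have := ler_wpM2l (mulr_ge0 K0 B0) h2; lra.
    move=> s t sI tI; rewrite !fE // ler_norml.
    have := half s t sI tI; have := half t s tI sI; rewrite (distrC t s) => h1 h2.
    by apply/andP; split; lra.
  have [L HL] := lip.
  apply: (strictly_convex_of_midpoint HL) => s t s0 st tt0.
  pose m := (s + t) / 2; pose h := (t - s) / 2.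
  have h0 : 0 < h by rewrite /h; lra.
  have sI : s \in `[0, t0] by rewrite in_itv/=; apply/andP; split; lra.
  have tI : t \in `[0, t0] by rewrite in_itv/=; apply/andP; split; lra.
  have mI : m \in `[0, t0] by rewrite in_itv/= /m; apply/andP; split; lra.
  have [vs _ cs ths ds] := HV s sI; have [vm _ cm thm dm] := HV m mI.
  have [vt _ ct tht dt] := HV t tI.
  have pi20 : 0 < (pi : R) / 2 by lra.
  have [A1 /andP[A10 A1p] bs] := row_bound pi20 ths.
  have [A2 /andP[A20 A2p] bm] := row_bound pi20 thm.
  have [A3 /andP[A30 A3p] bt] := row_bound pi20 tht.
  pose A := Num.max A1 (Num.max A2 A3).
  have A0 : 0 <= A by rewrite le_max A10.
  have Ap : A < pi / 2 by rewrite !gt_max A1p A2p A3p.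
  have bs' k : `|theta s 0 k| <= A by rewrite le_max bs.
  have bm' k : `|theta m 0 k| <= A by rewrite !le_max bm orbT.
  have bt' k : `|theta t 0 k| <= A by rewrite !le_max bt !orbT.
  have E1 : cisdiag (V m) (theta m) = cisdiag g (h *: xi) *m cisdiag (V s) (theta s).
    have -> : h = m - s by rewrite /m /h; field.
    by rewrite -cm -cs (curve_step s m).
  have E2 : cisdiag (V t) (theta t) = cisdiag g (h *: xi) *m cisdiag (V m) (theta m).
    have -> : h = t - m by rewrite /m /h; field.
    by rewrite -cm -ct (curve_step m t).
  have [le eq] := wsum_phase_midpoint hmu A0 Ap gu vs vm vt ds dm dt bs' bm' bt' E1 E2.
  rewrite !fE // -/m ltr_pdivlMr // mulrC lt_neqAle le andbT; apply/eqP => /eq comm.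
  apply: nxy.
  (* Otherwise e^{ih'x} has eigenvalue -1 at h' = pi / |xi_k| <= h, although it is a quotient of two
     points of the curve, both with numerical range in the right half plane. *)
  have hxi k : `|h * xi 0 k| < pi.
    rewrite normrM (gtr0_norm h0) ltNge; apply/negP => big.
    have xk0 : 0 < `|xi 0 k|.
      by rewrite lt_neqAle normr_ge0 andbT; apply/eqP => e; move: big; rewrite -e mulr0 leNgt p0.
    have [h' [h'0 h'E h'h]] : exists h', [/\ 0 < h', h' * `|xi 0 k| = pi & h' <= h].
      exists (pi / `|xi 0 k|); split; first by rewrite divr_gt0.
        by rewrite mulfVK // lt0r_neq0.
      by rewrite ler_pdivrMr.
    have rI : s + h' \in `[0, t0].
      rewrite in_itv/=; rewrite /h in h'h; clear -s0 st tt0 h'0 h'h.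
      by apply/andP; split; lra.
    have [vr _ cr thr dr] := HV _ rI.
    have [A4 /andP[A40 A4p] br] := row_bound pi20 thr.
    have B0 : 0 <= Num.max A1 A4 by rewrite le_max A10.
    have Bp : Num.max A1 A4 < pi / 2 by rewrite gt_max A1p A4p.
    have bs'' k' : `|theta s 0 k'| <= Num.max A1 A4 by rewrite le_max bs.
    have br'' k' : `|theta (s + h') 0 k'| <= Num.max A1 A4 by rewrite le_max br orbT.
    have E : cisdiag (V (s + h')) (theta (s + h')) = cisdiag g (h' *: xi) *m cisdiag (V s) (theta s).
      have Es : s + h' - s = h' by ring.
      by rewrite -cr -cs (curve_step s (s + h')) Es.
    have := cis_quotient_neqN1 k B0 Bp vr vs gu bs'' br'' E.
    move/eqP; apply; rewrite mxE.
    have [x0|x0] := leP 0 (xi 0 k).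
      rewrite (ger0_norm x0) in h'E; rewrite h'E /cis cospi sinpi.
      by apply/eqP; rewrite eq_complex/= oppr0 !eqxx.
    rewrite (ltr0_norm x0) in h'E.
    have -> : h' * xi 0 k = - pi by rewrite -h'E mulrN opprK.
    by rewrite /cis cosN sinN cospi sinpi oppr0; apply/eqP; rewrite eq_complex/= oppr0 !eqxx.
  (* By the bound just shown, x is a function of e^{ihx}, so it inherits commutation with u(s). *)
  have xcs : comm_mx (curve x y s) x.
    rewrite cs xE; apply: (udiag_comm gu (esym comm)) => j k; rewrite !mxE => /cis_inj H.
    congr (_%:C); apply: (mulfI (lt0r_neq0 h0)); apply: H.
    by apply: le_lt_trans (ler_normB _ _) _; have := hxi j; have := hxi k; lra.
  have xY : comm_mx x (cisdiag gy eta).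
    have xX : x *m cisdiag g (- (s *: xi)) = cisdiag g (- (s *: xi)) *m x.
      by rewrite xE /hdiag /cisdiag !udiagM //; congr udiag; apply/rowP => k; rewrite !mxE mulrC.
    have -> : cisdiag gy eta = cisdiag g (- (s *: xi)) *m curve x y s.
      by rewrite curveE mulmxA -cisdiagD // addNr cisdiag0 // mul1mx.
    have gen (G c : 'M[R[i]]_n) : x *m G = G *m x -> comm_mx c x -> comm_mx x (G *m c).
      by rewrite /comm_mx => xG cx; rewrite mulmxA xG -!mulmxA cx.
    exact: gen.
  (* The bound on [opnorm y] enters here: eigenvalues of y differ by less than 2 pi, so y is a
     function of e^{iy}. *)
  rewrite yE; apply: (udiag_comm gyu xY) => j k; rewrite !mxE => /cis_inj -> //.
  have ypi' l : `|eta 0 l| < pi.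
    by apply: le_lt_trans ypi; rewrite yE; exact: opnorm_hdiag_ge.
  by apply: le_lt_trans (ler_normB _ _) _; have := ypi' j; have := ypi' k; lra.
Qed.
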